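(* Let $\mathbf G=\{G_1,G_2,\ldots\}$ be a countable family of countable sets satisfying conditions (g$_1$), (g$_2$) and (g$_3$) of the context, and let $\mathcal V$ be a normal linear subspace of $\mathcal W$ such that $\mathcal V_{\mathcal P}\subseteq\mathcal V\subseteq\mathcal V_{\mathcal S}$. Then, for every $\mathbf G_1\subseteq\mathbf G$, $$\mathcal S^{\mathbf G_1}\cap\mathcal V=\overline{\operatorname{conv}}\,\mathcal P^{\mathbf G_1},$$ where $\overline{\operatorname{conv}}\,\mathcal P^{\mathbf G_1}$ is the closure of the convex hull of $\mathcal P^{\mathbf G_1}$ in the Mackey topology $\mathfrak T_{\mathrm m}(\mathcal V,\mathcal V')$.
   Context: $\mathbf G=\{G_1,G_2,\ldots\}$ is a (finite or infinite) countable family of countable sets, which may have non-empty intersections. $G$ is the simple graph whose vertex set is $\bigcup_kG_k$ (also denoted $G$), two distinct vertices being joined by an edge if and only if they belong to the same set $G_k$ for some $k$. $\mathcal W$ is the linear space of real-valued functions on the vertex set of $G$. For $\mathbf G_1\subseteq\mathbf G$, $\mathcal S^{\mathbf G_1}$ is the set of all non-negative $w\in\mathcal W$ such that $\sum_{g\in G_k}w(g)\le1$ for every $G_k\in\mathbf G$ and $\sum_{g\in G_k}w(g)=1$ for every $G_k\in\mathbf G_1$. $\mathcal P^{\mathbf G_1}$ is the set of those $w\in\mathcal S^{\mathbf G_1}$ which take only the values $0$ and $1$. $\mathcal S^\emptyset,\mathcal P^\emptyset$ are these sets for $\mathbf G_1=\emptyset$. A path $g_0\to g_1\to\dots\to g_l$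 in $G$ is a sequence of vertices in which consecutive vertices are joined by an edge. A path is a cycle if $g_0=g_l$ and the number of distinct vertices $g_j$ is at least $3$. A path is admissible if no three adjacent (i.e. consecutive) vertices of it belong to the same set $G_k$; for a cycle $g_0\to\dots\to g_l=g_0$ adjacency is understood cyclically (so the triple $g_{l-1},g_0,g_1$ is included), and its number of vertices is $l$. Conditions: (g$_1$) every vertex of $G$ belongs to at most two of the sets $G_k$; (g$_2$) every admissible cycle in $G$ has an even number of vertices; (g$_3$) one can enumerate the sets $G_j$ in such a way that, with $F_n:=\bigcup_{k\le n}G_k$, either $G=F_n$ for all sufficiently large $n$ or $G_{n+1}\not\subset F_n$ for all sufficiently large $n$ (every finite family satisfies (g$_3$)). The normal cover of a set $\Omega\subseteq\mathcal W$ is the set of all $\tilde w\in\mathcal W$ such that, for some $w\in\Omega$, $|\tilde w(g)|\le|w(g)|$ for all $g$; $\Omega$ is normal if it equals its normal cover. $\mathcal V_{\mathcal P}$ and $\mathcal V_{\mathcal S}$ are the normal covers of the linear spans of $\mathcal P^\emptyset$ and $\mathcal S^\emptyset$ respectively. For a linear subspace $\mathcal V\subseteq\mathcal W$ containing all finitely supported functions, $\mathcal V'$ is the space of all $w'\in\mathcal W$ with $\sum_g|w(g)w'(g)|<\infty$ for all $w\in\mathcal V$, and $\langle w,w'\rangle:=\sum_gw(g)w'(g)$. $\mathfrak T_{\mathrm w}(\mathcal V',\mathcal V)$ is the weak topology on $\mathcal V'$ defined by the functionals $\langle w,\cdot\rangle$, $w\in\mathcal V$. The Mackey topology $\mathfrak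 T_{\mathrm m}(\mathcal V,\mathcal V')$ on $\mathcal V$ is generated by the seminorms $w\mapsto\sup_{w'\in\Omega'}|\langle w,w'\rangle|$, where $\Omega'$ runs over all absolutely convex $\mathfrak T_{\mathrm w}(\mathcal V',\mathcal V)$-compact subsets of $\mathcal V'$. *)

(* Defs.v *)
From HB Require Import structures.
From mathcomp Require Import all_boot all_order all_algebra.
From mathcomp Require Import all_classical all_reals all_analysis.

Set Implicit Arguments.
Unset Strict Implicit.
Unset Printing Implicit Defensive.

Import Order.TTheory GRing.Theory Num.Theory.
Import numFieldNormedType.Exports.

Local Open Scope classical_set_scope.
Local Open Scope ring_scope.

(* A family of sets of vertices is a set GG : set (set T) of subsets of the
   vertex type T; the sets of GG are assumed to cover T. *)
Section Graph.
Variable T : choiceType.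
Implicit Types GG : set (set T).

Definition countable_family GG : Prop :=
  [/\ countable GG, forall A, GG A -> countable A &
      \bigcup_(A in GG) A = [set: T]].

Definition adj GG : rel T :=
  fun x y => `[< x != y /\ exists A, [/\ GG A, A x & A y] >].

(* A closed path g_0 -> ... -> g_l = g_0 is encoded by the sequence
   c = [:: g_0; ...; g_(l-1)], whose size is l. *)
Definition graph_cycle GG (c : seq T) : Prop :=
  path.cycle (adj GG) c /\ (2 < size (undup c))%N.

(* The cyclically consecutive triples of c are the triples at the front of
   the rotations of c. *)
Definition admissible_cycle GG (c : seq T) : Prop :=
  graph_cycle GG c /\
  forall i x y z s, rot i c = [:: x, y, z & s] ->
    ~ exists A, [/\ GG A, A x, A y & A z].

Definition cond_g1 GG : Prop :=
  forall x : T, ([set A | GG A /\ A x] #<= `I_2)%card.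

Definition cond_g2 GG : Prop :=
  forall c : seq T, admissible_cycle GG c -> ~~ odd (size c).

(* An enumeration of GG is a bijection e from an initial segment D of nat
   onto GG (D is all of nat when GG is infinite). *)
Definition cond_g3 GG : Prop :=
  exists (D : set nat) (e : nat -> set T),
    [/\ forall m n, (m <= n)%N -> D n -> D m, set_bij D GG e &
      let F n := \bigcup_(k in [set k | D k /\ (k <= n)%N]) e k in
      (\forall n \near \oo, F n = [set: T]) \/
      (\forall n \near \oo, D n.+1 -> ~ (e n.+1 `<=` F n))].

End Graph.

Section LinearHulls.
Variables (R : realType) (M : lmodType R).

Definition linear_subspace (A : set M) : Prop :=
  A 0 /\ forall (a : R) (u v : M), A u -> A v -> A (a *: u + v).

Definition linear_span (A : set M) : set M := smallest linear_subspace A.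

Definition conv_hull (A : set M) : set M := smallest (@convex_set R M) A.

Definition absolutely_convex (A : set M) : Prop :=
  forall (a b : R) (u v : M), A u -> A v -> `|a| + `|b| <= 1 ->
    A (a *: u + b *: v).

End LinearHulls.

Notation vfun R T := (T -> R^o).

Section FunctionSpaces.
Variables (R : realType) (T : choiceType).

Implicit Types (GG : set (set T)) (w : vfun R T) (V Omega : set (vfun R T)).

Definition S_set GG (GG1 : set (set T)) : set (vfun R T) :=
  [set w | [/\ forall g, 0 <= w g,
      forall A, GG A -> (\esum_(g in A) (w g)%:E <= 1)%E &
      forall A, GG1 A -> (\esum_(g in A) (w g)%:E = 1)%E]].

Definition P_set GG (GG1 : set (set T)) : set (vfun R T) :=
  S_set GG GG1 `&` [set w | forall g, w g = 0 \/ w g = 1].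

Definition normal_cover Omega : set (vfun R T) :=
  [set w' | exists2 w, Omega w & forall g, `|w' g| <= `|w g|].

Definition normal_set Omega : Prop := Omega = normal_cover Omega.

Definition V_P GG : set (vfun R T) := normal_cover (linear_span (P_set GG set0)).

Definition V_S GG : set (vfun R T) := normal_cover (linear_span (S_set GG set0)).

Definition dual_space V : set (vfun R T) :=
  [set w' | forall w, V w -> summable [set: T] (fun g => (w g * w' g)%:E)].

(* The sum of an absolutely summable family, as the difference of the sums of
   its positive and negative parts; only used when w * w' is summable. *)
Definition pairing w w' : R :=
  fine (\esum_(g in [set: T]) (Num.max (w g * w' g) 0)%:E) -
  fine (\esum_(g in [set: T]) (Num.max (- (w g * w' g)) 0)%:E).

(* Aliases of the subtypes V' and V, so that they do not inherit the topology
   of pointwise convergence. *)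
Definition weak_dual V : Type := set_type (dual_space V).

Definition mackey_space V : Type := set_type V.

HB.instance Definition _ V := Choice.on (weak_dual V).

HB.instance Definition _ V := Choice.on (mackey_space V).

Definition weak_subbase V : set_system (weak_dual V) :=
  [set U | exists w, V w /\ exists2 B : set R, open B &
    U = [set w' : weak_dual V | B (pairing w (set_val w'))]].

HB.instance Definition _ V :=
  isSubBaseTopological.Build (weak_dual V) (@weak_subbase V) id.

Definition mackey_index V Omega : Prop :=
  [/\ Omega `<=` dual_space V, absolutely_convex Omega &
      compact (set_val @^-1` Omega : set (weak_dual V))].

(* The supremum is finite for Omega as in mackey_index and w in V. *)
Definition sup_seminorm Omega w : R :=
  sup [set `|pairing w w'| | w' in Omega].

Definition mackey_subbase V : set_system (mackey_space V) :=
  [set U | exists Omega, mackey_index V Omega /\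
    exists (v : mackey_space V) (r : R), 0 < r /\
    U = [set w | sup_seminorm Omega (set_val w - set_val v) < r]].

HB.instance Definition _ V :=
  isSubBaseTopological.Build (mackey_space V) (@mackey_subbase V) id.

Definition mackey_closure V (A : set (vfun R T)) : set (vfun R T) :=
  set_val @` closure (set_val @^-1` A : set (mackey_space V)).

End FunctionSpaces.

(* Main.v *)
Require Import Defs.
From HB Require Import structures.
From mathcomp Require Import all_boot all_order all_algebra finmap.
From mathcomp Require Import all_classical all_reals all_analysis.
From mathcomp Require Import ring lra zify.

Set Implicit Arguments.
Unset Strict Implicit.
Unset Printing Implicit Defensive.

Import Order.TTheory GRing.Theory Num.Theory.
Import numFieldNormedType.Exports.

Local Open Scope classical_set_scope.
Local Open Scope ring_scope.

(** Why the theorem holds.  Take the sets of the family as nodes and the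
vertices of G as edges, a vertex joining the at most two sets that contain it.
Condition (g2) makes this multigraph bipartite ([two_coloring]): a shortest odd
closed walk of sets would yield an odd admissible cycle.  Hence S is the set of
row and column substochastic weights of a bipartite multigraph, and P consists
of the indicators of its matchings.

The closure lies in S and in V because S is convex and is cut out by conditions
on the values w(g) and on the numbers <w, 1_A> (A in the family), and these
functionals belong to V' since V is contained in V_S.

The converse rests on [P_set_pairing_ge]: for w in S^G1 and in V, w' in V' and
eps > 0, some p in P^G1 satisfies <p, w'> >= <w, w'> - eps.  On finitely many
vertices this is a form of Birkhoff's theorem ([fin_birkhoff]): the maximum over
the substochastic polytope of a linear form plus a small strictly convex
quadratic form is attained only at 0/1 points, because the equations tight at a
fractional point leave room for a perturbation ([balanced_vector], where
bipartiteness enters).  For infinitely many vertices p is a pointwise limit of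
finite matchings p_n, each chosen to be good for a penalized weight.  The
penalty pays for every set A of G1 not yet met by p_n inside a fixed finite part
B of A that carries almost all the mass of w on A; so the limit still meets A,
and mass cannot escape to infinity.

So w is in the weak closure of conv P^G1.  To reach the Mackey closure, fix a
compact absolutely convex Omega in V', and suppose that every c in the hull is
at distance at least eps from w in the seminorm of Omega.  Then each of the
compact sets of w' in Omega with <w - c, w'> >= eps / 2 is nonempty, and the
minimax principle ([finite_minimax]) upgrades this to the finite intersection
property.  A common point w' contradicts [P_set_pairing_ge]
([weak_mackey_closure]). *)

(** * Balanced vectors for two partitions of a finite set *)

Section BalancedVector.
Local Open Scope set_scope.
Variables (R : realFieldType) (I J : finType).
Implicit Types (r c : I -> J).

Let cls r a := [set i | r i == a].
Let crowded r := [set a | (1 < #|cls r a|)%N].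

Lemma card_crowded r :
  (2 * #|crowded r| + #|[set i | r i \notin crowded r]| <= #|I|)%N.
Proof.
rewrite -cardsT -(cardsID [set i | r i \in crowded r] [set: I]%SET).
rewrite finset.setTI finset.setTD.
have -> : (~: [set i | r i \in crowded r])%SET = [set i | r i \notin crowded r].
  by apply/setP => i; rewrite !inE.
rewrite leq_add2r.
have -> : #|[set i | r i \in crowded r]| = (\sum_(a in crowded r) #|cls r a|)%N.
  rewrite -sum1_card (partition_big r (mem (crowded r)))/=; last first.
    by move=> i; rewrite !inE.
  apply: eq_bigr => a ab; rewrite -sum1_card; apply: eq_bigl => i.
  by rewrite !inE; case: eqP => [->|]; rewrite ?andbF// andbT; move: ab; rewrite inE.
rewrite mulnC -sum_nat_const; apply: leq_sum => a.
by rewrite inE.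
Qed.

(** Two partitions of I, with classes the fibres of r and of c: some nonzero
vector has sum 0 over every class with at least two points.  This is a rank
count: at most #|I| / 2 classes of each kind are crowded, so there are at most
#|I| equations; and if there are exactly #|I|, then every point is in a crowded
class of both kinds, so that the sum of the r-equations equals the sum of the
c-equations and the system is still degenerate. *)
Lemma balanced_vector r c : (0 < #|I|)%N ->
  exists d : I -> R, (exists i, d i != 0) /\
    (forall i j, i != j -> r i = r j -> \sum_(l | r l == r i) d l = 0) /\
    (forall i j, i != j -> c i = c j -> \sum_(l | c l == c i) d l = 0).
Proof.
move=> I0.
pose n := #|I|; pose p := #|crowded r|; pose q := #|crowded c|.
pose M : 'M[R]_(n, p + q) := row_mx
  (\matrix_(i, a) (r (enum_val i) == enum_val a)%:R)
  (\matrix_(i, a) (c (enum_val i) == enum_val a)%:R).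
have kerM : (\rank M < n)%N -> exists d : I -> R, (exists i, d i != 0) /\
    (forall i j, i != j -> r i = r j -> \sum_(l | r l == r i) d l = 0) /\
    (forall i j, i != j -> c i = c j -> \sum_(l | c l == c i) d l = 0).
  move=> rkM.
  have : kermx M != 0 by rewrite -mxrank_eq0 mxrank_ker subn_eq0 -ltnNge.
  case/rowV0Pn => u /sub_kermxP uM u0.
  have {uM} [ur uc] :
      u *m (\matrix_(i, a) (r (enum_val i) == enum_val a)%:R) = 0 :> 'rV_p
     /\ u *m (\matrix_(i, a) (c (enum_val i) == enum_val a)%:R) = 0 :> 'rV_q.
    by move: uM; rewrite mul_mx_row -[0]row_mx0 => /eq_row_mx.
  exists (fun i => u 0 (enum_rank i)); split.
    case/rV0Pn: u0 => k uk; exists (enum_val k).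
    by rewrite enum_valK.
  have gen (h : I -> J) :
      u *m (\matrix_(i, a) (h (enum_val i) == enum_val a)%:R) = 0
        :> 'rV_#|crowded h| ->
      forall i j, i != j -> h i = h j ->
      \sum_(l | h l == h i) u 0 (enum_rank l) = 0.
    move=> uh i j ij hij.
    have hib : h i \in crowded h.
      rewrite inE; apply/card_gt1P; exists i, j; split => //; rewrite inE //.
      by rewrite hij.
    have /rowP/(_ (enum_rank_in hib (h i))) := uh.
    rewrite !mxE => e; rewrite (reindex _ (onW_bij _ (enum_val_bij I)))/=.
    rewrite big_mkcond -[RHS]e; apply: eq_bigr => k _.
    rewrite !mxE enum_rankK_in// enum_valK.
    by case: eqP; rewrite ?mulr1 ?mulr0.
  by split; [exact: gen ur | exact: gen uc].
have := card_crowded r; have := card_crowded c.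
rewrite -/n -/p -/q => hc hr.
have [pq|pq] := ltnP (p + q) n.
  by apply: kerM; apply: leq_ltn_trans pq; exact: rank_leq_col.
have [p2 q2] : (2 * p = n /\ 2 * q = n)%N by lia.
have gen (h : I -> J) : #|[set i | h i \notin crowded h]| = 0%N ->
    forall i, h i \in crowded h.
  move=> /eqP; rewrite cards_eq0 => /eqP/setP h0 i.
  by have := h0 i; rewrite !inE => /negbT; rewrite negbK.
have {gen} [rb cb] : (forall i, r i \in crowded r) /\ (forall i, c i \in crowded c).
  by split; apply: gen; lia.
apply: kerM; rewrite ltnNge; apply/negP => nM.
have /row_fullP[N NM] : row_full M.
  by rewrite /row_full eqn_leq rank_leq_col; apply: leq_trans nM; lia.
(* the dependency between the equations: r-equations minus c-equations *)
pose v : 'cV[R]_(p + q) := col_mx (const_mx 1) (const_mx (-1)).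
have Mv : M *m v = 0.
  rewrite mul_row_col; apply/colP => i; rewrite !mxE.
  rewrite (bigD1 (enum_rank_in (rb (enum_val i)) (r (enum_val i))))//= !mxE.
  rewrite enum_rankK_in// eqxx big1 ?addr0; last first.
    move=> a ai; rewrite !mxE mulr1; case: eqP => // e.
    by move: ai; rewrite -(inj_eq enum_val_inj) enum_rankK_in// e eqxx.
  rewrite (bigD1 (enum_rank_in (cb (enum_val i)) (c (enum_val i))))//= !mxE.
  rewrite enum_rankK_in// eqxx big1 ?addr0; last first.
    move=> a ai; rewrite !mxE; case: eqP => // e; last by rewrite mul0r.
    by move: ai; rewrite -(inj_eq enum_val_inj) enum_rankK_in// e eqxx.
  by rewrite !mul1r subrr.
have v0 : v = 0 by rewrite -[v]mul1mx -NM -mulmxA Mv mulmx0.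
have p0 : (0 < p)%N by lia.
have /eqP := congr1 (fun v : 'cV_(p + q) => v (lshift q (Ordinal p0)) 0) v0.
by rewrite col_mxEu !mxE oner_eq0.
Qed.

End BalancedVector.

(** * Birkhoff's theorem on finitely many vertices *)

Section FiniteBirkhoff.
Variable R : realType.

Lemma small_step (I : finType) (a b : I -> R) : (forall i, 0 < a i) ->
  exists2 t : R, 0 < t & forall i, t * `|b i| <= a i.
Proof.
move=> a0; exists (\big[Num.min/1]_i (a i / (`|b i| + 1))).
  by apply: lt_bigmin => // i _; rewrite divr_gt0// ltr_wpDl.
move=> i; apply: (@le_trans _ _ (a i / (`|b i| + 1) * `|b i|)).
  by rewrite ler_wpM2r// bigmin_le.
by rewrite -mulrA ler_piMr ?(ltW (a0 i))// mulrC ler_pdivrMr ?ltr_wpDl// mul1r lerDl.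
Qed.

Lemma sum_continuous (U : topologicalType) (I : Type) (s : seq I) (P : pred I)
    (F : I -> U -> R) : (forall i, P i -> continuous (F i)) ->
  continuous (fun x => \sum_(i <- s | P i) F i x).
Proof. by move=> cF; apply: continuous_big => //; exact: add_continuous. Qed.

(** The classes of r play the part of the rows (or columns) of a matrix with
entries v. *)
Definition substochastic n (J : eqType) (r : 'I_n -> J) (v : 'rV[R]_n) :=
  (forall i, 0 <= v 0 i) /\ forall i, \sum_(l | r l == r i) v 0 l <= 1.

Lemma substochastic_le1 n (J : eqType) (r : 'I_n -> J) v i :
  substochastic r v -> v 0 i <= 1.
Proof.
case=> v0 vr; apply: le_trans (vr i); rewrite (bigD1 i)//= lerDl.
by apply: sumr_ge0 => *; exact: v0.
Qed.

Lemma closed_substochastic n (J : eqType) (r : 'I_n -> J) :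
  closed (substochastic r).
Proof.
rewrite (_ : substochastic r =
    (\bigcap_(i in [set: 'I_n]) [set v : 'rV[R]_n | 0 <= v 0 i]) `&`
    (\bigcap_(i in [set: 'I_n]) [set v : 'rV[R]_n | \sum_(l | r l == r i) v 0 l <= 1])).
  apply: closedI; apply: closed_bigI => i _.
    apply: (@closed_comp _ _ (fun v : 'rV[R]_n => v 0 i) [set x | 0 <= x]).
      by move=> v _; exact: coord_continuous.
    exact: closed_ge.
  apply: (@closed_comp _ _ (fun v : 'rV[R]_n => \sum_(l | r l == r i) v 0 l)
    [set x | x <= 1]).
    move=> v _; apply: sum_continuous => l _; exact: coord_continuous.
  exact: closed_le.
apply/seteqP; split => v; first by case=> v0 vr; split => i _ /=.
by case=> v0 vr; split => i; [exact: v0|exact: vr].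
Qed.

Lemma compact_substochastic2 n (J : eqType) (r c : 'I_n -> J) :
  compact (substochastic r `&` substochastic c).
Proof.
apply: (@subclosed_compact _ _
  [set v : 'rV[R]_n | forall i, `[0, 1]%classic (v ord0 i)]).
- exact: (closedI (@closed_substochastic _ _ r) (@closed_substochastic _ _ c)).
- apply: (@rV_compact R n (fun=> `[0, 1]%classic)) => i; exact: segment_compact.
- move=> v [vr _] i /=; rewrite in_itv/= (substochastic_le1 i vr) andbT.
  by case: vr.
Qed.

(** The perturbation D moves only fractional coordinates and annihilates each
class with at least two of them.  A tight class cannot have exactly one, since
the other entries would be 0 or 1; so tight constraints are preserved, and the
slack ones tolerate a small step. *)
Lemma fractional_step n (J : eqType) (r : 'I_n -> J) (v : 'rV[R]_n)
    (D : 'I_n -> R) :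
  substochastic r v ->
  (forall i, ~~ (0 < v 0 i < 1) -> D i = 0) ->
  (forall i j, i != j -> 0 < v 0 i < 1 -> 0 < v 0 j < 1 -> r i = r j ->
     \sum_(l | r l == r i) D l = 0) ->
  exists2 t, 0 < t & forall s, `|s| <= t ->
    substochastic r (\row_i (v 0 i + s * D i)).
Proof.
move=> sv D0 Dr; have [v0 vr] := sv.
have [|t1 t10 t1P] := @small_step 'I_n
  (fun i => if 0 < v 0 i < 1 then v 0 i else 1) D.
  by move=> i; case: ifP => // /andP[].
pose S i := \sum_(l | r l == r i) v 0 l.
have [|t2 t20 t2P] := @small_step 'I_n
  (fun i => if S i < 1 then 1 - S i else 1)
  (fun i => \sum_(l | r l == r i) D l).
  by move=> i; case: ifP => //; rewrite subr_gt0.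
have tight i : 1 <= S i -> \sum_(l | r l == r i) D l = 0.
  move=> Si; have {}Si : S i = 1 by apply/eqP; rewrite eq_le Si vr.
  have [/existsP[j /andP[/eqP ji fj]]|/existsPn nofrac] :=
    boolP [exists j, (r j == r i) && (0 < v 0 j < 1)]; last first.
    by apply: big1 => l li; apply: D0; have := nofrac l; rewrite li.
  move: Si; rewrite /S -ji => Sj.
  have [l /andP[/eqP lj nlj] l0] : exists2 l, (r l == r j) && (l != j) & 0 < v 0 l.
    apply: contrapT => no; move: Sj; rewrite (bigD1 j)//= big1 ?addr0.
      by move=> e; move: fj; rewrite e ltxx andbF.
    move=> l lj; apply/eqP; rewrite eq_le v0 andbT leNgt; apply/negP => l0.
    by apply: no; exists l.
  apply: (Dr j l) => //; first by rewrite eq_sym.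
  rewrite l0/=; have := Sj; rewrite (bigD1 j)//= (bigD1 l)/=; last first.
    by rewrite lj eqxx.
  set X := \sum_(_ | _) _ => e.
  have : 0 <= X by apply: sumr_ge0 => *; exact: v0.
  by move/andP: fj => [j0 _]; lra.
exists (Num.min t1 t2); first by rewrite lt_min t10.
move=> s; rewrite le_min => /andP[st1 st2].
have bd (t x y : R) : `|s| <= t -> t * `|x| <= y -> - y <= s * x <= y.
  move=> st xy; rewrite -ler_norml normrM; apply: le_trans xy.
  by rewrite ler_wpM2r.
split => i.
  rewrite mxE; have := bd _ _ _ st1 (t1P i).
  case: ifP => [_ /andP[h _]|/negbT/D0 -> _]; last by rewrite mulr0 addr0.
  by lra.
under eq_bigr do rewrite mxE; rewrite big_split/= -mulr_sumr -/(S i).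
have := bd _ _ _ st2 (t2P i).
case: ltP => [_ /andP[_ h]|/tight -> _]; first lra.
by rewrite mulr0 addr0 vr.
Qed.

(** Birkhoff's theorem in the approximate form that is needed below: an integral
point of the polytope costs no more than w, up to eps.  Maximize minus the cost
plus d times the sum of squares.  At a maximizer v with a fractional coordinate
both v + tD and v - tD would be feasible for a balanced D, and the strict
convexity of the square contradicts maximality; d is so small that the quadratic
term changes the value by at most eps. *)
Lemma fin_birkhoff n (J : eqType) (r c : 'I_n -> J) (w k : 'I_n -> R) (eps : R) :
  0 < eps -> substochastic r (\row_i w i) -> substochastic c (\row_i w i) ->
  exists p : pred 'I_n,
    [/\ forall i j, p i -> p j -> r i = r j -> i = j,
        forall i j, p i -> p j -> c i = c j -> i = j &
        \sum_(i | p i) k i <= \sum_i w i * k i + eps].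
Proof.
move=> e0 wr wc.
pose A := substochastic r `&` substochastic c : set 'rV[R]_n.
pose d := eps / n.+1%:R.
have d0 : 0 < d by rewrite divr_gt0.
pose f (v : 'rV[R]_n) := \sum_i (d * (v 0 i * v 0 i) - v 0 i * k i).
have cf : {within A, continuous f}.
  apply: continuous_subspaceT; apply: sum_continuous => i _ v.
  have cv : (fun u : 'rV[R]_n => u 0 i) @ v --> v 0 i by exact: coord_continuous.
  exact: (cvgB (cvgM (cvg_cst _) (cvgM cv cv)) (cvgM cv (cvg_cst _))).
have [|v] := compact_EVT_max _ (compact_substochastic2 (r := r) (c := c)) cf.
  by exists (\row_i w i).
rewrite inE => -[vr vc] vmax.
have v01 i : 0 <= v 0 i <= 1 by rewrite (substochastic_le1 i vr) andbT; case: vr.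
have integral i : ~~ (0 < v 0 i < 1).
  apply/negP => fi.
  pose F := [pred i | 0 < v 0 i < 1].
  pose K : finType := {i : 'I_n | i \in F}.
  pose cls (h : 'I_n -> J) (x : K) : {set 'I_n} := [set l | h l == h (val x)]%SET.
  have clsP h x y : (cls h x == cls h y) = (h (val x) == h (val y)).
    apply/eqP/eqP => [/setP/(_ (val x))|e]; first by rewrite !inE eqxx => /esym/eqP.
    by apply/setP => l; rewrite !inE e.
  have [|d1 [[x0 dx0] [dr dc]]] := @balanced_vector R K _ (cls r) (cls c).
    by apply/card_gt0P; exists (exist _ i fi : K).
  pose D l := if insub l is Some x then d1 (x : K) else 0.
  have Dval x : D (val x) = d1 x by rewrite /D valK.
  have D0 l : ~~ (0 < v 0 l < 1) -> D l = 0.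
    by move=> nl; rewrite /D insubN.
  have Dsum h : (forall x y : K, x != y -> cls h x = cls h y ->
        \sum_(l | cls h l == cls h x) d1 l = 0) ->
      forall i j, i != j -> 0 < v 0 i < 1 -> 0 < v 0 j < 1 -> h i = h j ->
     \sum_(l | h l == h i) D l = 0.
    move=> dh a b ab fa fb hab.
    pose x : K := exist _ a fa; pose y : K := exist _ b fb.
    have := dh x y; rewrite -val_eqE/= => /(_ ab).
    have -> : cls h x = cls h y by apply/eqP; rewrite clsP/= hab.
    move=> /(_ erefl) e; rewrite -[RHS]e.
    rewrite (bigID F)/= [X in _ + X]big1 ?addr0; last by move=> l /andP[_ /D0].
    under eq_bigl do rewrite andbC.
    rewrite (big_sub_cond F (fun l => h l == h a) D).
    by apply: eq_big => [z|z _]; rewrite ?Dval// clsP/= hab.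
  have [t1 t10 t1P] := fractional_step vr D0 (Dsum _ dr).
  have [t2 t20 t2P] := fractional_step vc D0 (Dsum _ dc).
  pose t := Num.min t1 t2.
  have t0 : 0 < t by rewrite lt_min t10.
  have fle s : `|s| <= t -> f (\row_i (v 0 i + s * D i)) <= f v.
    rewrite le_min => /andP[s1 s2]; apply: vmax; rewrite inE.
    by split; [exact: t1P|exact: t2P].
  have := fle t; have := fle (- t).
  rewrite normrN (ger0_norm (ltW t0)) => /(_ (lexx _)) h1 /(_ (lexx _)) h2.
  have : f (\row_i (v 0 i + t * D i)) + f (\row_i (v 0 i + - t * D i)) - f v - f v
      = d * t * t * (2 * \sum_i (D i * D i)).
    rewrite !mulr_sumr /f -big_split/= -!sumrB; apply: eq_bigr => l _.
    by rewrite !mxE; ring.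
  have : 0 < \sum_i D i * D i.
    rewrite (bigD1 (val x0))//= Dval; apply: ltr_wpDr.
      by apply: sumr_ge0 => l _; rewrite -expr2 sqr_ge0.
    by rewrite -expr2 lt0r sqrf_eq0 dx0 sqr_ge0.
  move=> /(mulr_gt0 (ltr0n _ 2)) /(mulr_gt0 (mulr_gt0 (mulr_gt0 d0 t0) t0)).
  by lra.
have vE i : v 0 i = (v 0 i == 1)%:R.
  case: eqP => // n1; have := integral i; have := v01 i.
  case/andP=> a b; rewrite negb_and -!leNgt => /orP[|h].
    by move=> a'; apply/eqP; rewrite eq_le a a'.
  by case: n1; apply/eqP; rewrite eq_le b h.
exists (fun i => v 0 i == 1).
have inj h : substochastic h v -> forall i j : 'I_n, v 0 i == 1 ->
    v 0 j == 1 -> h i = h j -> i = j.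
  case=> v0 hv i j /eqP vi /eqP vj hij; apply/eqP/negPn/negP => ij.
  have := hv i; rewrite (bigD1 i)//= (bigD1 j)/=; last by rewrite hij eqxx eq_sym.
  rewrite vi vj.
  have : 0 <= \sum_(i0 < n | (h i0 == h i) && (i0 != i) && (i0 != j)) v 0 i0.
    by apply: sumr_ge0 => *; exact: v0.
  by lra.
split; [exact: inj vr|exact: inj vc|].
have := vmax (\row_i w i); rewrite inE => /(_ (conj wr wc)).
rewrite /f !sumrB -!mulr_sumr.
have -> : \sum_(i < n) v 0 i * k i = \sum_(i < n | v 0 i == 1) k i.
  rewrite [RHS]big_mkcond; apply: eq_bigr => i _; rewrite {1}vE.
  by case: ifP; rewrite ?mul1r ?mul0r.
have -> : \sum_(i < n) (\row_i0 w i0) 0 i * k i = \sum_(i < n) w i * k i.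
  by apply: eq_bigr => i _; rewrite mxE.
have h1 : 0 <= d * \sum_(i < n) (\row_i0 w i0) 0 i * (\row_i0 w i0) 0 i.
  by rewrite mulr_ge0 ?(ltW d0)// sumr_ge0// => i _; rewrite -expr2 sqr_ge0.
have h2 : d * (\sum_(i < n) v 0 i * v 0 i) <= eps.
  apply: (@le_trans _ _ (d * n.+1%:R)); last by rewrite /d divfK.
  rewrite ler_pM2l//; apply: (@le_trans _ _ (\sum_(i < n) 1)).
    apply: ler_sum => i _; have /andP[a b] := v01 i.
    by rewrite -[1]mulr1 ler_pM.
  by rewrite sumr_const card_ord ler_nat.
by lra.
Qed.

End FiniteBirkhoff.

(** * Bipartiteness of the intersection graph of the family *)

Lemma next_three (X : eqType) (A B C : X) s : uniq [:: A, B, C & s] ->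
  [/\ next [:: A, B, C & s] A = B, next [:: A, B, C & s] B = C,
      A != B, A != C & B != C].
Proof.
rewrite /= !inE !negb_or => /and3P[/and3P[AB AC _] /andP[BC _] _].
by rewrite !eqxx eq_sym (negbTE AB); split.
Qed.

Section Coloring.
Variables (T : choiceType) (GG : set (set T)).
Hypotheses (g1 : cond_g1 GG) (g2 : cond_g2 GG).

Definition meets : rel (set T) := fun A B =>
  `[< [/\ GG A, GG B, A != B & A `&` B !=set0] >].

Lemma meets_sym : symmetric meets.
Proof.
by move=> A B; apply/asboolP/asboolP => -[? ? ? ?]; split => //;
  rewrite 1?eq_sym// setIC.
Qed.

(** This is the form in which (g1) is used. *)
Lemma at_most_two x A B C : GG A -> GG B -> GG C -> A x -> B x -> C x ->
  [\/ A = B, B = C | A = C].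
Proof.
move=> GA GB GC Ax Bx Cx.
have [f] := pcard_leP (g1 x).
have fin (X : set T) : GG X -> X x -> f X = 0%N \/ f X = 1%N.
  move=> GX Xx; have : `I_2 (f X) by apply: (@funS _ _ _ _ f).
  by rewrite /=; case: (f X) => [|[|]]//; [left|right].
have inj (X Y : set T) : GG X -> GG Y -> X x -> Y x -> f X = f Y -> X = Y.
  by move=> *; apply: (@inj _ _ _ f) => //; rewrite inE.
have [eA|eA] := fin _ GA Ax; have [eB|eB] := fin _ GB Bx;
  have [eC|eC] := fin _ GC Cx;
  by [apply: Or31; apply: inj => //; rewrite eA eB |
      apply: Or32; apply: inj => //; rewrite eB eC |
      apply: Or33; apply: inj => //; rewrite eA eC].
Qed.

Lemma rot_three (c : seq (set T)) A : (2 < size c)%N -> A \in c ->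
  exists i B C s, rot i c = [:: A, B, C & s].
Proof.
move=> c2 Ac; case: (rot_to Ac) => i s e; exists i.
have : size (rot i c) = size c by rewrite size_rot.
rewrite e; case: s {e} => [|B [|C s]]/= es; [by lia|by lia|].
by exists B, C, s.
Qed.

(** A simple cycle A_0, ..., A_(l-1) of pairwise distinct sets, l >= 3, gives
vertices h(A_i) in the intersection of A_i and A_(i+1).  By (g1) a vertex in
A_i and A_(i+1) lies in no other set, so these vertices are distinct and form
an admissible cycle of length l, to which (g2) applies. *)
Lemma uniq_cycle_even (c : seq (set T)) :
  uniq c -> path.cycle meets c -> ~~ odd (size c).
Proof.
move=> uc cc; have [c2|c2] := leqP (size c) 2.
  case: c c2 cc {uc} => [|A [|B [|]]]//= _; rewrite andbT.
  by move=> /asboolP[_ _]; rewrite eqxx.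
have Mnext A : A \in c -> meets A (next c A) by exact: next_cycle.
have [t0 _] : exists t0 : T, True.
  case: c c2 {uc cc} Mnext => // A c _ /(_ A); rewrite inE eqxx => /(_ isT).
  by move=> /asboolP[_ _ _ [t _]]; exists t.
pose h A := xget t0 (A `&` next c A).
have hP A : A \in c -> A (h A) /\ next c A (h A).
  move=> /Mnext/asboolP[_ _ _ [t tA]]; apply/(@xgetPex _ t0 (A `&` next c A)).
  by exists t.
have cG A : A \in c -> GG A by move=> /Mnext/asboolP[].
have cN A : A \in c -> next c A != A.
  by move=> /Mnext/asboolP[_ _]; rewrite eq_sym.
have NN A : A \in c -> next c (next c A) != A.
  move=> /(rot_three c2)[i [B [C [s e]]]].
  rewrite -!(next_rot i uc) e.
  have : uniq (rot i c) by rewrite rot_uniq.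
  by rewrite e => /next_three[-> -> _ + _]; rewrite eq_sym.
have nc A : A \in c -> next c A \in c by rewrite mem_next.
have hinj : {in c &, injective h}.
  move=> A B Ac Bc hAB; apply: contrapT => AB.
  have [hA hnA] := hP _ Ac; have [] := hP _ Bc; rewrite -hAB => hB hnB.
  have BnA : B = next c A.
    have [//|/eqP|] := at_most_two (cG _ Bc) (cG _ Ac) (cG _ (nc _ Ac)) hB hA hnA.
    - by move=> /esym.
    - by rewrite eq_sym (negbTE (cN _ Ac)).
    - by [].
  have [/eqP|/eqP|/eqP] := at_most_two (cG _ (nc _ Bc)) (cG _ Ac) (cG _ Bc) hnB hA hB.
  - by rewrite BnA (negbTE (NN _ Ac)).
  - by move=> /eqP.
  - by rewrite (negbTE (cN _ Bc)).
rewrite -(size_map h); apply: g2; split; first split.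
- rewrite cycle_map.
  apply: (@sub_in_cycle _ (mem c) (frel (next c)) _ _ _ _ (cycle_next uc)).
    move=> A B Ac Bc /eqP nAB; apply/asboolP; split.
      by apply/eqP => /(hinj _ _ Ac Bc) AB; have := cN _ Ac; rewrite nAB AB eqxx.
    exists B; split; first exact: cG.
      by rewrite -nAB; case: (hP _ Ac).
    by case: (hP _ Bc).
  by apply/allP.
- by rewrite undup_id ?size_map// map_inj_in_uniq.
move=> i x y z s; rewrite -map_rot.
have : uniq (rot i c) by rewrite rot_uniq.
have mr A : (A \in rot i c) = (A \in c) by rewrite mem_rot.
case e : (rot i c) => [|A [|B [|C s']]]// u [<- <- <- _] [X [GX XA XB XC]].
have Ac : A \in c by rewrite -mr e inE eqxx.
have Bc : B \in c by rewrite -mr e !inE eqxx orbT.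
have Cc : C \in c by rewrite -mr e !inE eqxx !orbT.
have [nA nB AB AC BC] := next_three u.
rewrite -!e !(next_rot i uc) in nA nB.
have two D Y : D \in c -> Y (h D) -> GG Y -> Y = D \/ Y = next c D.
  move=> Dc YD GY; have [h1 h2] := hP _ Dc.
  have [||] := at_most_two GY (cG _ Dc) (cG _ (nc _ Dc)) YD h1 h2; [by left| |by right].
  by move=> /esym/eqP; rewrite (negbTE (cN _ Dc)).
have XeB : X = B.
  have [//|XC'] := two _ _ Bc XB GX; have [XA'|] := two _ _ Ac XA GX.
    by move: AC; rewrite -XA' XC' nB eqxx.
  by rewrite nA.
have [e1|] := two _ _ Cc XC GX.
  by move: BC; rewrite -XeB e1 eqxx.
rewrite XeB -nA => /(congr1 (prev c)); rewrite !prev_next// => /eqP.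
by rewrite (negbTE AC).
Qed.

(** A closed walk with a repeated node splits there into two shorter closed
walks, so that a shortest odd one would be simple. *)
Lemma cycle_even (c : seq (set T)) : path.cycle meets c -> ~~ odd (size c).
Proof.
have [n] := ubnP (size c); elim: n c => // n IH c cn cc.
have [uc|/(uniqPn set0)[i [j [ij jc eij]]]] := boolP (uniq c).
  exact: uniq_cycle_even.
have ic : (i < size c)%N by exact: ltn_trans jc.
set x := nth set0 c i in eij.
have xin : x \in drop i.+1 c.
  by rewrite eij -(subnKC ij) -nth_drop mem_nth// size_drop ltn_sub2r//; lia.
have erot : rot i c = x :: drop i.+1 c ++ take i c.
  by rewrite /rot (drop_nth set0).
case/splitPr: xin erot => p1 p2 erot.
move: cc; rewrite -(rot_cycle i) erot => cc.
have szc : size c = ((size p1).+1 + (size (p2 ++ take i c)).+1)%N.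
  by rewrite -(size_rot i) erot -catA/= size_cat/=; lia.
have c1 : path.cycle meets (x :: p1) /\ path.cycle meets (x :: p2 ++ take i c).
  move: cc; rewrite -catA /= rcons_cat /= cat_path /=.
  by move=> /and3P[h1 h2 h3]; rewrite rcons_path h1.
have o1 : ~~ odd (size (x :: p1)).
  apply: IH c1.1 => /=; move: cn; rewrite szc ltnS; apply: leq_trans.
  by rewrite addSn addnS !ltnS leq_addr.
have o2 : ~~ odd (size (x :: p2 ++ take i c)).
  apply: IH c1.2 => /=; move: cn; rewrite szc ltnS; apply: leq_trans.
  by rewrite addSn !ltnS leq_addl.
by rewrite szc oddD (negbTE o1) (negbTE o2).
Qed.

(** The colour of a set is the parity of the walks that join it to a chosen
representative of its connected component. *)
Lemma two_coloring : exists color : set T -> bool,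
  forall A B, meets A B -> color A != color B.
Proof.
pose conn A := [set B | exists2 p, path meets A p & last A p = B].
pose root A := xget set0 (conn A).
have connP A B : conn A B -> conn B A.
  move=> [p pp <-]; exists (rev (belast A p)).
    by rewrite rev_path; under eq_path do rewrite meets_sym.
  case: p {pp} => //= B' p; by rewrite rev_cons last_rcons.
have connT A B C : conn A B -> conn B C -> conn A C.
  move=> [p pp <-] [q qq <-]; exists (p ++ q); first by rewrite cat_path pp.
  by rewrite last_cat.
have rootP A : conn (root A) A.
  by apply: connP; apply: (@xgetPex _ set0 (conn A)); exists A; exists [::].
pose even_walk A := exists p,
  [/\ path meets (root A) p, last (root A) p = A & ~~ odd (size p)].
pose color A := `[< even_walk A >].
exists color => A B mAB.
have cAB : conn A B by exists [:: B] => //=; rewrite mAB.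
have rAB : root A = root B.
  rewrite /root; congr xget; apply/seteqP; split => C.
    by apply: connT; apply: connP.
  exact: connT.
have mBA : meets B A by rewrite meets_sym.
apply/negP => /eqP cc.
have [[p [pp pA op]]|no] := asboolP (even_walk A).
  have : color B by rewrite -cc; apply/asboolP; exists p.
  move=> /asboolP[q]; rewrite -rAB => -[qq qB oq].
  have := @cycle_even (root A :: p ++ rev q).
  rewrite /= rcons_cat cat_path pp pA -rev_cons lastI qB rev_rcons /= mAB.
  have -> : path meets B (rev (belast (root A) q)).
    by rewrite -qB rev_path; under eq_path do rewrite meets_sym.
  rewrite size_cat size_rev oddD => /(_ isT).
  by case: (odd _) op oq => //; case: (odd _).
have : ~ color A by move=> /asboolP.
rewrite cc; apply; apply/asboolP; rewrite /even_walk -rAB.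
have [p pp pA] := rootP A.
exists (rcons p B); rewrite rcons_path pp pA last_rcons mAB size_rcons /=; split => //.
by apply/negP => op; apply: no; exists p; split.
Qed.

End Coloring.

(** * Finite matchings *)

Section FiniteMatching.
Variables (R : realType) (T : choiceType).
Implicit Types (A : set T) (s : seq T).

Lemma le_esum_seq A s (f : T -> R) : uniq s -> (forall x, x \in s -> A x) ->
  ((\sum_(x <- s) f x)%:E <= \esum_(x in A) (f x)%:E)%E.
Proof.
move=> us sA; apply: esum_ge; exists [set` s].
  by split => //; exact: finite_seq.
by rewrite -fsbig_seq// sumEFin.
Qed.

Lemma esum_le_seq A (f : T -> R) (M : \bar R) :
  (forall s, uniq s -> (forall x, x \in s -> A x) ->
     ((\sum_(x <- s) f x)%:E <= M)%E) ->
  (\esum_(x in A) (f x)%:E <= M)%E.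
Proof.
move=> fM; apply: ge_ereal_sup => _ [X [finX XA] <-].
rewrite fsbig_finite// sumEFin; apply: fM; first exact: fset_uniq.
by move=> x; rewrite in_fset_set// inE => /XA.
Qed.

Lemma S_set_sum_le1 (GG GG1 : set (set T)) (w : vfun R T) A s :
  S_set GG GG1 w -> GG A -> uniq s -> (forall x, x \in s -> A x) ->
  \sum_(x <- s) w x <= 1.
Proof.
case=> _ wA _ GA us sA; rewrite -lee_fin; apply: le_trans (wA _ GA).
exact: le_esum_seq.
Qed.

(** A 0/1 function has sum at most 1 over each set of the family exactly when
its support is a matching. *)
Definition matching (GG : set (set T)) (p : pred T) :=
  forall A x y, GG A -> A x -> A y -> p x -> p y -> x = y.

(** The sets of each colour are pairwise disjoint, so that, after adding
singletons for the vertices that they miss, they partition the vertices: the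
two colours are the rows and the columns of the finite Birkhoff theorem. *)
Lemma light_matching (GG GG1 : set (set T)) (w k : vfun R T) s (eps : R) :
  \bigcup_(A in GG) A = [set: T] -> cond_g1 GG -> cond_g2 GG ->
  S_set GG GG1 w -> uniq s -> 0 < eps ->
  exists p : pred T, [/\ matching GG p, forall x, p x -> x \in s &
    \sum_(x <- s | p x) k x <= \sum_(x <- s) w x * k x + eps].
Proof.
move=> cov g1 g2 Sw us e0; have [color colorP] := two_coloring g1 g2.
pose cand b x := [set A | [/\ GG A, color A = b & A x]].
pose row b x : set T := xget [set x] (cand b x).
have rowP b x : row b x x /\ (GG (row b x) \/ row b x = [set x]).
  by rewrite /row; case: xgetP => [_ -> [? _ ?]|]; split => //; [left|right].
have rowE A x : GG A -> A x -> row (color A) x = A.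
  move=> GA Ax; have : cand (color A) x (row (color A) x).
    by apply: (@xgetPex _ [set x] (cand (color A) x)); exists A.
  case=> GB cB Bx; apply/eqP/negPn/negP => BA.
  have : meets GG (row (color A) x) A.
    by apply/asboolP; split => //; exists x.
  by move/colorP; rewrite cB eqxx.
have class_le b x r : uniq r -> (forall y, y \in r -> row b y = row b x) ->
    \sum_(y <- r) w y <= 1.
  move=> ur rx.
  have rr y : y \in r -> row b x y by move=> /rx <-; case: (rowP b y).
  have [xb [Gx|ex]] := rowP b x; first exact: S_set_sum_le1 Sw Gx ur rr.
  have : [set: T] x by []. rewrite -cov => -[A GA Ax].
  apply: (S_set_sum_le1 Sw GA ur) => y /rr; rewrite ex => ->.
  exact: Ax.
pose t := in_tuple s; pose v i := w (tnth t i).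
have tinj : injective (tnth t) by apply/tuple_uniqP.
have sub b : substochastic (row b \o tnth t) (\row_i v i).
  split=> i; first by rewrite mxE; case: Sw => w0 _ _; exact: w0.
  under eq_bigr do rewrite mxE.
  rewrite /v -(big_tnth _ _ s (fun y => row b y == row b (tnth t i)) w) -big_filter.
  apply: (@class_le b (tnth t i)); first by rewrite filter_uniq.
  by move=> y; rewrite mem_filter => /andP[/eqP].
have [p0 [pr pc pk]] := fin_birkhoff (fun i => k (tnth t i)) e0 (sub true) (sub false).
pose p x := [exists i, p0 i && (tnth t i == x)].
have pE i : p (tnth t i) = p0 i.
  apply/existsP/idP => [[j /andP[pj /eqP /tinj <-]]//|pi].
  by exists i; rewrite pi eqxx.
exists p; split.
- move=> A x y GA Ax Ay /existsP[i /andP[pi /eqP xi]] /existsP[j /andP[pj /eqP yj]].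
  rewrite -xi -yj; congr tnth.
  have : row (color A) x = row (color A) y by rewrite (rowE A x)// (rowE A y).
  rewrite -xi -yj.
  by case: (color A); [exact: pr|exact: pc].
- by move=> x /existsP[i /andP[_ /eqP <-]]; exact: mem_tnth.
- rewrite big_tnth [X in _ <= X + _]big_tnth.
  by under eq_bigl do rewrite pE.
Qed.

End FiniteMatching.

(** * Unconditional sums *)

Section UnconditionalSums.
Variables (R : realType) (T : choiceType).
Implicit Types (f g h : T -> R) (s : seq T).

Definition abs_summable f := summable [set: T] (fun x => (f x)%:E).

(** The pairing of w and w' is usum of their product; this detaches its
theory from the duality. *)
Definition usum f : R :=
  fine (\esum_(x in [set: T]) (Num.max (f x) 0)%:E) -
  fine (\esum_(x in [set: T]) (Num.max (- f x) 0)%:E).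

Lemma ge_esum_seqP f (M : \bar R) :
  (\esum_(x in [set: T]) (f x)%:E <= M)%E <->
  (forall s, uniq s -> ((\sum_(x <- s) f x)%:E <= M)%E).
Proof.
split=> [fM s us|fM]; last by apply: esum_le_seq => s us _; exact: fM.
by apply: le_trans fM; exact: le_esum_seq.
Qed.

Lemma abs_summableP f :
  abs_summable f <-> exists M, forall s, uniq s -> \sum_(x <- s) `|f x| <= M.
Proof.
rewrite /abs_summable /summable.
have E : (\esum_(x in [set: T]) `|(f x)%:E| = \esum_(x in [set: T]) (`|f x|)%:E)%E.
  by apply: eq_esum.
rewrite E; split=> [fin|[M fM]]; last first.
  apply: (@le_lt_trans _ _ M%:E); last exact: ltry.
  by apply/ge_esum_seqP => s us; rewrite lee_fin fM.
exists (fine (\esum_(x in [set: T]) (`|f x|)%:E)) => s us.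
rewrite -lee_fin fineK; last first.
  by rewrite ge0_fin_numE// esum_ge0// => x _; rewrite lee_fin.
by move: s us; apply/ge_esum_seqP.
Qed.

Lemma ler_sum_subseq h s s' : (forall x, 0 <= h x) -> uniq s -> uniq s' ->
  {subset s <= s'} -> \sum_(x <- s) h x <= \sum_(x <- s') h x.
Proof.
move=> h0 us us' ss'; rewrite [leRHS](bigID (mem s))/=.
rewrite -[X in _ <= X + _]big_filter [X in _ <= X + _](perm_big s).
  by rewrite lerDl sumr_ge0.
apply: uniq_perm => //; first exact: filter_uniq.
move=> x; rewrite mem_filter; apply/andP/idP => [[]//|xs]; split => //.
exact: ss'.
Qed.

Lemma nneg_esum_approx h (M : R) : (forall x, 0 <= h x) ->
  (forall s, uniq s -> \sum_(x <- s) h x <= M) ->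
  forall eps : R, 0 < eps -> exists2 s, uniq s &
    forall s', uniq s' -> {subset s <= s'} ->
    `|fine (\esum_(x in [set: T]) (h x)%:E) - \sum_(x <- s') h x| <= eps.
Proof.
move=> h0 hM eps e0.
set S := (\esum_(x in [set: T]) (h x)%:E)%E.
have S0 : (0 <= S)%E by apply: esum_ge0 => x _; rewrite lee_fin.
have Sfin : S \is a fin_num.
  rewrite ge0_fin_numE//; apply: (@le_lt_trans _ _ M%:E); last exact: ltry.
  by apply/ge_esum_seqP => s us; rewrite lee_fin hM.
have Sle s : uniq s -> \sum_(x <- s) h x <= fine S.
  by move=> us; rewrite -lee_fin fineK//; move: s us; apply/ge_esum_seqP.
have [s us hs] : exists2 s, uniq s & fine S - eps < \sum_(x <- s) h x.
  apply: contrapT => no; have : (S <= (fine S - eps)%:E)%E.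
    apply/ge_esum_seqP => s us; rewrite lee_fin leNgt; apply/negP => hs.
    by apply: no; exists s.
  by rewrite -{1}[S]fineK// lee_fin; lra.
exists s => // s' us' ss'.
have := ler_sum_subseq h0 us us' ss'; have := Sle _ us'.
by rewrite ler_norml; lra.
Qed.

(** An absolutely summable family has usum as the limit of its finite partial
sums along the directed set of finite sets of indices; together with
[usum_unique] this reduces algebraic properties of usum to finite sums. *)
Lemma usum_approx f eps : abs_summable f -> 0 < eps ->
  exists2 s, uniq s & forall s', uniq s' -> {subset s <= s'} ->
    `|usum f - \sum_(x <- s') f x| <= eps.
Proof.
move=> /abs_summableP[M fM] e0.
have e20 : 0 < eps / 2 by rewrite divr_gt0.
have bd h : (forall x, h x <= `|f x|) -> forall s, uniq s -> \sum_(x <- s) h x <= M.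
  by move=> hf s us; apply: le_trans (fM s us); exact: ler_sum.
have [||s1 us1 h1] := @nneg_esum_approx (fun x => Num.max (f x) 0) M _ _ _ e20.
- by move=> x; rewrite le_max lexx orbT.
- by apply: bd => x; rewrite ge_max ler_norm normr_ge0.
have [||s2 us2 h2] := @nneg_esum_approx (fun x => Num.max (- f x) 0) M _ _ _ e20.
- by move=> x; rewrite le_max lexx orbT.
- by apply: bd => x; rewrite ge_max -normrN ler_norm normr_ge0.
exists (undup (s1 ++ s2)); first exact: undup_uniq.
move=> s' us' ss'.
have /(h1 _ us') : {subset s1 <= s'}.
  by move=> x xs; apply: ss'; rewrite mem_undup mem_cat xs.
have /(h2 _ us') : {subset s2 <= s'}.
  by move=> x xs; apply: ss'; rewrite mem_undup mem_cat xs orbT.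
have -> : \sum_(x <- s') f x =
    \sum_(x <- s') Num.max (f x) 0 - \sum_(x <- s') Num.max (- f x) 0.
  rewrite -sumrB; apply: eq_bigr => x _.
  by have [?|?] := leP (f x) 0; have [?|?] := leP (- f x) 0; lra.
rewrite /usum !ler_norml => /andP[a b] /andP[c d].
by apply/andP; split; lra.
Qed.

Lemma usum_unique f (L : R) : abs_summable f ->
  (forall eps, 0 < eps -> exists2 s, uniq s &
    forall s', uniq s' -> {subset s <= s'} ->
    `|L - \sum_(x <- s') f x| <= eps) -> usum f = L.
Proof.
move=> sf hL; apply/eqP; rewrite -subr_eq0 -normr_le0.
apply/ler_addgt0Pr => eps e0; rewrite add0r.
have e20 : 0 < eps / 2 by rewrite divr_gt0.
have [s1 us1 h1] := hL _ e20; have [s2 us2 h2] := usum_approx sf e20.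
pose s := undup (s1 ++ s2).
have us : uniq s by exact: undup_uniq.
have /(h1 _ us) : {subset s1 <= s} by move=> x xs; rewrite mem_undup mem_cat xs.
have /(h2 _ us) : {subset s2 <= s}.
  by move=> x xs; rewrite mem_undup mem_cat xs orbT.
by rewrite !ler_norml => /andP[a b] /andP[c d]; apply/andP; split; lra.
Qed.

Lemma abs_summable_lin f g (a b : R) : abs_summable f -> abs_summable g ->
  abs_summable (fun x => a * f x + b * g x).
Proof.
move=> /abs_summableP[M fM] /abs_summableP[N gN]; apply/abs_summableP.
exists (`|a| * M + `|b| * N) => s us.
apply: (@le_trans _ _ (\sum_(x <- s) (`|a| * `|f x| + `|b| * `|g x|))).
  by apply: ler_sum => x _; rewrite -!normrM ler_normD.
by rewrite big_split/= -!mulr_sumr lerD// ler_wpM2l// ?fM ?gN.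
Qed.

Lemma usum_lin f g (a b : R) : abs_summable f -> abs_summable g ->
  usum (fun x => a * f x + b * g x) = a * usum f + b * usum g.
Proof.
move=> sf sg; apply: usum_unique; first exact: abs_summable_lin.
move=> eps e0; pose d := eps / (`|a| + `|b| + 1).
have ab0 : 0 < `|a| + `|b| + 1 by rewrite ltr_wpDl// addr_ge0.
have d0 : 0 < d by rewrite divr_gt0.
have [s1 us1 h1] := usum_approx sf d0; have [s2 us2 h2] := usum_approx sg d0.
exists (undup (s1 ++ s2)); first exact: undup_uniq.
move=> s' us' ss'.
have /(h1 _ us') {}h1 : {subset s1 <= s'}.
  by move=> x xs; apply: ss'; rewrite mem_undup mem_cat xs.
have /(h2 _ us') {}h2 : {subset s2 <= s'}.
  by move=> x xs; apply: ss'; rewrite mem_undup mem_cat xs orbT.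
rewrite big_split/= -!mulr_sumr.
have -> : a * usum f + b * usum g -
      (a * (\sum_(x <- s') f x) + b * (\sum_(x <- s') g x)) =
    a * (usum f - \sum_(x <- s') f x) + b * (usum g - \sum_(x <- s') g x) by ring.
apply: le_trans (ler_normD _ _) _; rewrite !normrM.
apply: (@le_trans _ _ (`|a| * d + `|b| * d)).
  by apply: lerD; apply: ler_wpM2l.
rewrite -mulrDl -[leRHS](divfK (lt0r_neq0 ab0)) -/d mulrC ler_pM2l//.
by rewrite lerDl.
Qed.

Lemma abs_tail f eps : abs_summable f -> 0 < eps ->
  exists2 s, uniq s & forall s', uniq s' ->
    \sum_(x <- s' | x \notin s) `|f x| <= eps.
Proof.
move=> /abs_summableP[M fM] e0.
have [|||s us hs] := @nneg_esum_approx (fun x => `|f x|) M _ _ (eps / 2).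
- by [].
- by [].
- by rewrite divr_gt0.
exists s => // s' us'.
have u2 : uniq (undup (s ++ s')) by exact: undup_uniq.
have := hs _ us (fun _ => id).
have := hs _ u2; rewrite !ler_norml.
have sub : {subset s <= undup (s ++ s')} by move=> x xs; rewrite mem_undup mem_cat xs.
move=> /(_ sub) /andP[a b] /andP[c d].
have : \sum_(x <- undup (s ++ s')) `|f x| =
    \sum_(x <- s) `|f x| + \sum_(x <- s' | x \notin s) `|f x|.
  rewrite (bigID (mem s))/=; congr (_ + _).
    rewrite -big_filter; apply: perm_big.
    apply: uniq_perm => //; rewrite ?filter_uniq// => x.
    by rewrite mem_filter mem_undup mem_cat; case: (x \in s).
  rewrite -big_filter -[RHS]big_filter; apply: perm_big.
  apply: uniq_perm; rewrite ?filter_uniq// => x.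
  by rewrite !mem_filter mem_undup mem_cat; case: (x \in s).
by lra.
Qed.

Lemma usum_tail f eps : abs_summable f -> 0 < eps ->
  exists2 s, uniq s & `|usum f - \sum_(x <- s) f x| <= eps /\
    forall s', uniq s' -> \sum_(x <- s' | x \notin s) `|f x| <= eps.
Proof.
move=> sf e0; have [s1 us1 h1] := usum_approx sf e0.
have [s2 us2 h2] := abs_tail sf e0.
exists (undup (s1 ++ s2)); first exact: undup_uniq.
split; first by apply: h1 (undup_uniq _) _ => x xs; rewrite mem_undup mem_cat xs.
move=> s' us'; apply: le_trans (h2 _ us').
rewrite big_mkcond [leRHS]big_mkcond; apply: ler_sum => x _.
rewrite mem_undup mem_cat negb_or; case: (x \in s2); rewrite ?andbF// andbT.
by case: ifP.
Qed.

End UnconditionalSums.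

(** * Matchings that do almost as well as a given weight *)

Section GoodMatchings.
Variables (R : realType) (T : choiceType).
Implicit Types (s : seq T).

(** Compactness of the space of 0/1 functions: p is the limit of q along an
ultrafilter, and agrees with arbitrarily late q n on any finite set. *)
Lemma ultralimit (q : nat -> pred T) : exists p : pred T,
  forall s m, exists2 n, (m <= n)%N & forall x, x \in s -> q n x = p x.
Proof.
have [U [UU ooU]] := @ultraFilterLemma nat \oo _.
pose p x := `[< U [set n | q n x] >].
exists p => s m.
have Ux x : U [set n | q n x = p x].
  have [Uq|Uq] := in_ultra_setVsetC [set n | q n x] UU.
    have -> : p x = true by apply/asboolP.
    by [].
  have -> : p x = false.
    apply/negbTE/negP => /asboolP Up.
    have /filter_ex[n []//] : U (~` [set n | q n x] `&` [set n | q n x]).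
    exact: filterI.
  by apply: filterS Uq => n /= /negP/negbTE.
have : U [set n | forall x, x \in s -> q n x = p x].
  elim: s => [|y s IH]; first by apply: filterS filterT.
  have : U ([set n | q n y = p y] `&` [set n | forall x, x \in s -> q n x = p x]).
    exact: filterI.
  apply: filterS => n [/= h1 h2] x.
  by rewrite inE => /orP[/eqP ->|/h2].
have : U [set n | (m <= n)%N] by apply: ooU; exact: nbhs_infty_ge.
move=> Um Us.
have /filter_ex[n [mn hn]] : U ([set n | (m <= n)%N] `&`
    [set n | forall x, x \in s -> q n x = p x]) by exact: filterI.
by exists n.
Qed.

Lemma countable_enum (X : Type) (A : set X) : countable A ->
  exists e : nat -> option X, forall x, A x -> exists j, e j = Some x.
Proof.
move=> /countable_injP[f finj].
exists (fun j => if pselect (exists2 x, A x & f x = j) is left h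
  then Some (projT1 (cid2 h)) else None) => x Ax.
exists (f x); case: pselect => [h|[]]; last by exists x.
congr Some; case: cid2 => y Ay /= fy.
by apply: finj => //; rewrite inE.
Qed.

Lemma countable_exhaust : countable [set: T] ->
  exists u : nat -> seq T, forall s, exists m, forall n, (m <= n)%N ->
    {subset s <= u n}.
Proof.
move=> /countable_enum[e eP]; exists (fun n => pmap e (iota 0 n)).
elim=> [|x s [m IH]]; first by exists 0%N.
have [j ej] := eP x I.
exists (maxn j.+1 m) => n; rewrite geq_max => /andP[jn mn] y.
rewrite inE => /orP[/eqP ->|]; last exact: IH.
by rewrite mem_pmap; apply/mapP; exists j; rewrite ?mem_iota.
Qed.

Lemma matching_sum_le1 (GG : set (set T)) (p : pred T) (A : set T) s :
  matching GG p -> GG A -> uniq s -> (forall x, x \in s -> A x) ->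
  \sum_(x <- s) (p x)%:R <= 1 :> R.
Proof.
move=> mp GA; elim: s => [|x s IH]/=; first by rewrite big_nil.
move=> /andP[xs us] sA; rewrite big_cons.
have sA' y : y \in s -> A y by move=> ys; apply: sA; rewrite inE ys orbT.
case px: (p x); last by rewrite add0r IH.
rewrite big1_seq ?addr0// => y /= ys; case py : (p y) => //.
have xA : A x by apply: sA; rewrite inE eqxx.
by move: xs; rewrite (mp _ _ _ GA xA (sA' _ ys) px py) ys.
Qed.

Lemma geometric_le (eta : R) n (P : pred nat) : 0 <= eta ->
  \sum_(j <- iota 0 n | P j) eta / 2 ^+ j.+1 <= eta.
Proof.
move=> e0; apply: (@le_trans _ _ (\sum_(j <- iota 0 n) eta / 2 ^+ j.+1)).
  rewrite big_mkcond; apply: ler_sum => j _; case: ifP => // _.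
  by rewrite divr_ge0// exprn_ge0.
have -> : \sum_(j <- iota 0 n) eta / 2 ^+ j.+1 = eta - eta / 2 ^+ n.
  rewrite (_ : iota 0 n = index_iota 0 n); last by rewrite /index_iota subn0.
  elim: n => [|n IH]; first by rewrite big_nil expr0 divr1 subrr.
  rewrite big_nat_recr//= IH exprS; field.
  by rewrite expf_neq0.
by rewrite gerBl divr_ge0// exprn_ge0.
Qed.


(** The penalty N (1 - p(B j)) for missing B j is affine in p, so the finite
Birkhoff theorem applies to the weight k - N (sum of the indicators of B j).
The penalty of w itself is at most N eta because w has mass at least
1 - eta / 2^(j+1) on B j. *)
Lemma penalized_matching (GG GG1 : set (set T)) (w k : vfun R T) s n
    (P : pred nat) (B : nat -> seq T) (N eta delta : R) :
  \bigcup_(A in GG) A = [set: T] -> cond_g1 GG -> cond_g2 GG ->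
  S_set GG GG1 w -> uniq s -> 0 <= N -> 0 <= eta -> 0 < delta ->
  (forall j, (j < n)%N -> P j -> [/\ uniq (B j), {subset B j <= s} &
     1 - eta / 2 ^+ j.+1 <= \sum_(x <- B j) w x]) ->
  exists2 p : pred T, matching GG p &
    \sum_(x <- s) (p x)%:R * k x +
      N * \sum_(j <- iota 0 n | P j) (1 - \sum_(x <- B j) (p x)%:R) <=
    \sum_(x <- s) w x * k x + N * eta + delta.
Proof.
move=> cov g1 g2 Sw us N0 eta0 d0 BP.
pose kN x := k x - N * \sum_(j <- iota 0 n | P j) (x \in B j)%:R.
have [p [mp ps pk]] := light_matching kN cov g1 g2 Sw us d0.
exists p => //.
have expand (v : T -> R) : \sum_(x <- s) v x * kN x = \sum_(x <- s) v x * k x -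
    N * \sum_(j <- iota 0 n | P j) \sum_(x <- B j) v x.
  rewrite [X in _ - _ * X](_ : _ =
      \sum_(x <- s) v x * \sum_(j <- iota 0 n | P j) (x \in B j)%:R).
    by rewrite mulr_sumr -sumrB; apply: eq_bigr => x _; rewrite /kN; ring.
  under [RHS]eq_bigr do rewrite mulr_sumr.
  rewrite exchange_big/= big_seq_cond [RHS]big_seq_cond.
  apply: eq_bigr => j; rewrite mem_iota add0n => /andP[jn Pj].
  have [uB Bs _] := BP j jn Pj.
  transitivity (\sum_(x <- s | x \in B j) v x).
    rewrite -[RHS]big_filter; apply: perm_big.
    apply: uniq_perm => //; first exact: filter_uniq.
    move=> x; rewrite mem_filter; apply/idP/andP => [xB|[]//]; split => //.
    exact: Bs.
  rewrite big_mkcond; apply: eq_bigr => x _.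
  by case: ifP; rewrite ?mulr1 ?mulr0.
have pkE : \sum_(x <- s | p x) kN x = \sum_(x <- s) (p x)%:R * kN x.
  by rewrite big_mkcond; apply: eq_bigr => x _; case: ifP; rewrite ?mul1r ?mul0r.
rewrite pkE !expand in pk.
rewrite sumrB mulrBr.
have : N * (\sum_(j <- iota 0 n | P j) 1 -
    \sum_(j <- iota 0 n | P j) \sum_(x <- B j) w x) <= N * eta.
  apply: ler_wpM2l => //; rewrite -sumrB.
  apply: le_trans (geometric_le n P eta0).
  rewrite big_seq_cond [leRHS]big_seq_cond.
  apply: ler_sum => j; rewrite mem_iota add0n => /andP[jn Pj].
  by have [_ _] := BP j jn Pj; lra.
by lra.
Qed.

Lemma indicator_P_set (GG GG1 : set (set T)) (p : pred T) :
  matching GG p -> (forall A, GG1 A -> exists2 x, A x & p x) -> GG1 `<=` GG ->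
  P_set GG GG1 (fun x => (p x)%:R : R^o).
Proof.
move=> mp hp GG1G; split; last by move=> x /=; case: (p x); [right|left].
have le1 A : GG A -> (\esum_(g in A) ((p g)%:R : R)%:E <= 1)%E.
  move=> GA; apply: esum_le_seq => s us sA; rewrite lee_fin.
  exact: matching_sum_le1 mp GA us sA.
split => // A GA; apply/eqP; rewrite eq_le le1/=; last exact: GG1G.
have [x Ax px] := hp _ GA.
have := @le_esum_seq _ _ A [:: x] (fun x => (p x)%:R : R) isT.
rewrite big_seq1 px; apply => y; rewrite inE => /eqP ->; exact: Ax.
Qed.

(** Let F be a finite set of vertices outside which w |w'| has a small sum.
The weight k0 is - w' on F and |w'| elsewhere: its sum against w is close to
- <w, w'>, and, being nonnegative outside F, it lets the bounds on the finite
matchings pass to their pointwise limit.  The penalties force the limit to meet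
each set of G1. *)
Lemma P_set_pairing_ge (GG GG1 : set (set T)) (w w' : vfun R T) eps :
  countable_family GG -> cond_g1 GG -> cond_g2 GG -> GG1 `<=` GG ->
  S_set GG GG1 w -> abs_summable (fun x => w x * w' x) ->
  (forall p, P_set GG GG1 p -> abs_summable (fun x => p x * w' x)) ->
  0 < eps ->
  exists2 p, P_set GG GG1 p & pairing w w' - eps <= pairing p w'.
Proof.
move=> [cGG cA cov] g1 g2 GG1G Sw sw sp e0.
have [w0 wle wGG1] := Sw.
have [e eP] := countable_enum cGG.
have [u uP] : exists u : nat -> seq T, forall s, exists m, forall n, (m <= n)%N ->
    {subset s <= u n}.
  by apply: countable_exhaust; rewrite -cov; apply: bigcup_countable.
have w1 x : w x <= 1.
  have : [set: T] x by []. rewrite -cov => -[A GA Ax].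
  have := @S_set_sum_le1 _ _ _ _ _ _ [:: x] Sw GA isT.
  by rewrite big_seq1; apply => y; rewrite inE => /eqP ->.
pose d := eps / 5%:R.
have d0 : 0 < d by rewrite divr_gt0.
have [F uF [Fw Ftail]] := usum_tail sw d0.
pose C := \sum_(x <- F) `|w' x|.
have C0 : 0 <= C by apply: sumr_ge0.
(* N exceeds every bound on the total penalty obtained below, which makes a
   single missed B j impossible; eta is such that w is charged at most d *)
pose N := 3 * d + 2 * C + 1.
have N0 : 0 < N by rewrite /N; lra.
pose eta := d / N.
have eta0 : 0 < eta by rewrite divr_gt0.
have Neta : N * eta = d by rewrite mulrC divfK ?gt_eqF.
pose act j := `[< exists2 A, e j = Some A & GG1 A >].
have [B BP] : exists B : nat -> seq T, forall j A, e j = Some A -> GG1 A ->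
    [/\ uniq (B j), forall x, x \in B j -> A x &
      1 - eta / 2 ^+ j.+1 <= \sum_(x <- B j) w x].
  (* B j is a finite part of the j-th set, when that set is in G1, that carries
     all but eta / 2^(j+1) of the unit mass of w there *)
  suff /choice[B BP] : forall j, exists b, forall A, e j = Some A -> GG1 A ->
    [/\ uniq b, forall x, x \in b -> A x &
      1 - eta / 2 ^+ j.+1 <= \sum_(x <- b) w x] by exists B.
  move=> j.
  have [[A ej GA]|no] := pselect (exists2 A, e j = Some A & GG1 A); last first.
    by exists [::] => A ej GA; case: no; exists A.
  have [s [us sA sw1]] : exists s, [/\ uniq s, forall x, x \in s -> A x &
      1 - eta / 2 ^+ j.+1 <= \sum_(x <- s) w x].
    apply: contrapT => no.
    have : (\esum_(x in A) (w x)%:E <= (1 - eta / 2 ^+ j.+1)%:E)%E.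
      apply: esum_le_seq => s us sA; rewrite lee_fin leNgt; apply/negP => h.
      by apply: no; exists s; split => //; exact: ltW.
    rewrite wGG1// lee_fin; have : 0 < eta / 2 ^+ j.+1.
      by rewrite divr_gt0// exprn_gt0.
    by lra.
  by exists s => A'; rewrite ej => -[<-].
pose k0 x := if x \in F then - w' x else `|w' x|.
pose S n := undup (F ++ u n ++ flatten [seq B j | j <- iota 0 n]).
have uS n : uniq (S n) by exact: undup_uniq.
have FS n : {subset F <= S n} by move=> x xF; rewrite mem_undup mem_cat xF.
have sumF (v : T -> R) s : uniq s -> {subset F <= s} ->
    \sum_(x <- s) v x * k0 x = - \sum_(x <- F) v x * w' x +
      \sum_(x <- s | x \notin F) v x * `|w' x|.
  move=> us Fs; rewrite (bigID (mem F))/= -sumrN; congr (_ + _).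
    rewrite -big_filter big_seq_cond [RHS]big_seq_cond.
    rewrite (perm_big F); last first.
      apply: uniq_perm => //; first exact: filter_uniq.
      by move=> x; rewrite mem_filter; apply/andP/idP => [[]//|xF]; split; [|exact: Fs].
    apply: eq_big => [x|x /andP[]]; last first.
      by rewrite mem_filter /k0 => /andP[-> _] _; rewrite mulrN.
    rewrite mem_filter !andbT; apply/andP/idP => [[]//|xF]; split; [by []|exact: Fs].
  by apply: eq_bigr => x xF; rewrite /k0 (negbTE xF).
pose M := - \sum_(x <- F) w x * w' x.
have MC : M <= C.
  rewrite /M -sumrN; apply: ler_sum => x _.
  apply: le_trans (ler_norm _) _; rewrite normrN normrM ler_piMl//.
  by rewrite ger0_norm.
have level n : exists p : pred T, [/\ matching GG p,
    forall j, (j < n)%N -> act j -> exists2 x, x \in B j & p x &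
    forall s, uniq s -> {subset F <= s} -> {subset s <= S n} ->
      \sum_(x <- s) (p x)%:R * k0 x <= M + 3 * d].
  have BS j : (j < n)%N -> act j -> [/\ uniq (B j), {subset B j <= S n} &
     1 - eta / 2 ^+ j.+1 <= \sum_(x <- B j) w x].
    move=> jn /asboolP[A ej GA]; have [h1 h2 h3] := BP _ _ ej GA.
    split => // x xB; rewrite mem_undup !mem_cat; apply/orP; right; apply/orP; right.
    by apply/flattenP; exists (B j) => //; apply: map_f; rewrite mem_iota.
  have [p mp] := penalized_matching k0 cov g1 g2 Sw (uS n) (ltW N0) (ltW eta0) d0 BS.
  have wS : \sum_(x <- S n) w x * k0 x <= M + d.
    rewrite sumF// lerD2l; apply: le_trans (Ftail _ (uS n)).
    by apply: ler_sum => x _; rewrite normrM (ger0_norm (w0 x)).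
  have slack j : (j < n)%N -> act j -> 0 <= 1 - \sum_(x <- B j) (p x)%:R :> R.
    move=> jn /asboolP[A ej GA]; have [h1 h2 h3] := BP _ _ ej GA.
    by rewrite subr_ge0 (matching_sum_le1 mp (GG1G _ GA)).
  set pen := \sum_(_ <- iota 0 n | _) _; rewrite Neta => pk.
  have pen0 : 0 <= pen.
    rewrite /pen big_seq_cond; apply: sumr_ge0 => j.
    by rewrite mem_iota add0n => /andP[]; exact: slack.
  have tail0 s : 0 <= \sum_(x <- s | x \notin F) (p x)%:R * `|w' x|.
    by apply: sumr_ge0 => x _; rewrite mulr_ge0.
  have pF : - C <= - \sum_(x <- F) (p x)%:R * w' x.
    rewrite lerN2 ; apply: ler_sum => x _; case: (p x); rewrite ?mul1r ?mul0r//.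
    exact: ler_norm.
  exists p; split => //.
    move=> j jn aj; apply: contrapT => no.
    have B0 : \sum_(x <- B j) (p x)%:R = 0 :> R.
      rewrite big1_seq// => x /= xB; case px: (p x) => //.
      by case: no; exists x.
    have pen1 : 1 <= pen.
      rewrite /pen big_mkcond (bigD1_seq j)/= ?mem_iota ?iota_uniq//.
      rewrite aj B0 subr0 lerDl big_seq_cond; apply: sumr_ge0 => i.
      rewrite mem_iota add0n => /andP[iN _].
      by case: ifP => // ai; exact: slack.
    have : N * 1 <= N * pen by rewrite ler_pM2l.
    have := tail0 (S n); move: pk wS; rewrite [in X in X -> _]sumF// /N; lra.
  move=> s us Fs sS.
  have : \sum_(x <- s) (p x)%:R * k0 x <= \sum_(x <- S n) (p x)%:R * k0 x.
    rewrite !sumF// lerD2l -big_filter -[leRHS]big_filter.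
    apply: ler_sum_subseq; rewrite ?filter_uniq//.
    by move=> x; rewrite !mem_filter => /andP[-> /sS].
  have : 0 <= N * pen by rewrite mulr_ge0// ltW.
  by lra.
have [q qP] := choice level.
have [p pq] := ultralimit q.
have mp : matching GG p.
  move=> A x y GA Ax Ay px py.
  have [n _ qn] := pq [:: x; y] 0%N.
  have [mq _ _] := qP n; apply: mq GA Ax Ay _ _.
    by rewrite qn ?inE ?eqxx.
  by rewrite qn ?inE ?eqxx ?orbT.
have hit A : GG1 A -> exists2 x, A x & p x.
  move=> GA; have [j ej] := eP _ (GG1G _ GA).
  have aj : act j by apply/asboolP; exists A.
  have [n jn qn] := pq (B j) j.+1.
  have [_ hq _] := qP n; have [x xB qx] := hq _ jn aj.
  have [_ BA _] := BP _ _ ej GA.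
  by exists x; [exact: BA|rewrite -qn].
have pk s : uniq s -> {subset F <= s} ->
    \sum_(x <- s) (p x)%:R * k0 x <= M + 3 * d.
  move=> us Fs; have [m um] := uP s; have [n mn qn] := pq s m.
  have [_ _ hq] := qP n.
  apply: le_trans (hq s us Fs _).
    rewrite big_seq_cond [leRHS]big_seq_cond.
    by apply: ler_sum => x /andP[xs _]; rewrite qn.
  by move=> x xs; rewrite mem_undup !mem_cat (um n)// orbT.
have Pp := indicator_P_set mp hit GG1G.
exists (fun x => (p x)%:R) => //.
have [s us sP] := usum_approx (sp _ Pp) d0.
pose s' := undup (F ++ s).
have us' : uniq s' by exact: undup_uniq.
have Fs' : {subset F <= s'} by move=> x xF; rewrite mem_undup mem_cat xF.
have /(sP _ us') : {subset s <= s'} by move=> x xF; rewrite mem_undup mem_cat xF orbT.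
have lek : - \sum_(x <- s') (p x)%:R * k0 x <= \sum_(x <- s') (p x)%:R * w' x.
  rewrite -sumrN; apply: ler_sum => x _; rewrite -mulrN ler_wpM2l// /k0.
  case: ifP => _; first by rewrite opprK.
  by rewrite lerNl -normrN ler_norm.
have := pk s' us' Fs'.
move: Fw lek; rewrite !ler_norml /M /pairing -/(usum _) -/(usum _) /d.
rewrite -![usum _]/(pairing _ _).
move=> /andP[a b] c /= h /andP[h1 h2].
by lra.
Qed.

End GoodMatchings.

(** * Finite minimax principle and convex sets *)

Section Minimax.
Variable R : realType.

(** The f i are affine on the compact convex set K, whose convexity is expressed
by the existence of points z on which all f i interpolate linearly.  If every
average of the f i reaches r somewhere on K, then some x in K reaches r for all
f i at once.  Indeed let x minimize the sum of the squares of the deficits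
max(r - f i, 0).  If the deficits l i at x did not all vanish, then a point y
where the average with weights proportional to l reaches r would give a
direction in which the sum of squares decreases. *)
Lemma finite_minimax (X : topologicalType) (K : set X) (I : finType)
    (f : I -> X -> R) (r : R) :
  K !=set0 -> compact K -> (forall i, continuous (f i)) ->
  (forall x y t, K x -> K y -> 0 < t < 1 ->
     exists2 z, K z & forall i, f i z = f i x + t * (f i y - f i x)) ->
  (forall l : I -> R, (forall i, 0 <= l i) -> \sum_i l i = 1 ->
     exists2 x, K x & r <= \sum_i l i * f i x) ->
  exists2 x, K x & forall i, r <= f i x.
Proof.
move=> K0 cK cf segK hl.
pose g x := \sum_i Num.max (r - f i x) 0 ^+ 2.
have cg : {within K, continuous g}.
  apply: continuous_subspaceT; apply: sum_continuous => i _ x.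
  have cm : (fun y => Num.max (r - f i y) 0) @ x --> Num.max (r - f i x) 0.
    apply: (@continuous_max _ _ (fun y => r - f i y) (fun=> 0)).
      by apply: cvgB; [exact: cvg_cst|exact: cf].
    exact: cvg_cst.
  exact: (@continuous_comp _ _ _ _ (fun u : R => u ^+ 2) x cm
    (@exprn_continuous R 2 _)).
have [x] := compact_EVT_min K0 cK cg.
rewrite inE => Kx xmin; exists x => //.
pose l i := Num.max (r - f i x) 0.
have l0 i : 0 <= l i by rewrite le_max lexx orbT.
have [L0|L0] := eqVneq (\sum_i l i) 0.
  move=> i; have /eqP := L0; rewrite psumr_eq0// => /allP/(_ i).
  rewrite mem_index_enum => /(_ isT) /eqP.
  by rewrite /l; case: (leP (r - f i x) 0) => [|?]; lra.
have Lgt0 : 0 < \sum_i l i by rewrite lt0r L0 sumr_ge0.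
have [|| y Ky hy] := hl (fun i => l i / \sum_i l i).
- by move=> i; rewrite divr_ge0// ltW.
- by rewrite -mulr_suml divff.
have ly : r * \sum_i l i <= \sum_i l i * f i y.
  rewrite -ler_pdivlMr// mulr_suml.
  by under eq_bigr do rewrite mulrAC.
have lx : \sum_i l i * f i x < r * \sum_i l i.
  rewrite mulrC mulr_suml -subr_gt0 -sumrB.
  have E i : l i * r - l i * f i x = l i ^+ 2.
    by rewrite -mulrBr /l; case: (leP (r - f i x) 0) => h; rewrite ?expr2 ?mul0r.
  under eq_bigr do rewrite E.
  rewrite lt0r sumr_ge0 ?andbT; last by move=> i _; exact: sqr_ge0.
  apply: contra L0; rewrite !psumr_eq0//; last by move=> i _; exact: sqr_ge0.
  by move=> /allP h; apply/allP => i /h /=; rewrite sqrf_eq0.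
pose G := \sum_i l i * (f i y - f i x).
have G0 : 0 < G.
  by rewrite /G; under eq_bigr do rewrite mulrBr; rewrite sumrB subr_gt0; lra.
pose Q := \sum_i (f i y - f i x) ^+ 2.
have Q0 : 0 <= Q by apply: sumr_ge0 => i _; exact: sqr_ge0.
(* the sum of squares at x + t (y - x) is at most g x + t (t Q - 2 G) *)
have step t : 0 < t < 1 -> 0 <= t * (t * Q - 2 * G).
  move=> t01; have [z Kz fz] := segK x y t Kx Ky t01.
  have := xmin z; rewrite inE => /(_ Kz) gz.
  have : g z <= \sum_i (l i - t * (f i y - f i x)) ^+ 2.
    apply: ler_sum => i _; rewrite fz /l.
    set d := t * _; set u := f i x.
    rewrite -[leLHS]ger0_norm ?sqr_ge0// -[leRHS]ger0_norm ?sqr_ge0//.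
    rewrite !normrX ler_sqr ?nnegrE//.
    case: (leP (r - u) 0) => h; case: (leP (r - (u + d)) 0) => h';
      rewrite ?normr0//; try by rewrite normr_ge0.
      rewrite sub0r normrN ger0_norm; last lra.
      by have := ler_norm (- d); rewrite normrN; lra.
    by rewrite (_ : r - u - d = r - (u + d)) //; ring.
  move=> /(le_trans gz).
  rewrite /g -/(l _) -subr_ge0 -sumrB.
  suff -> : \sum_i ((l i - t * (f i y - f i x)) ^+ 2 - Num.max (r - f i x) 0 ^+ 2) =
    t * (t * Q - 2 * G) by [].
  rewrite /Q /G [t * \sum_i _]mulr_sumr [2 * \sum_i _]mulr_sumr.
  rewrite -sumrB mulr_sumr; apply: eq_bigr => i _.
  by rewrite -/(l i); ring.
have t0 : 0 < G / (Q + G + 1) < 1.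
  rewrite divr_gt0 ?ltr_pdivrMr ?mul1r; lra.
have := step _ t0; case/andP: (t0) => t00 t01.
rewrite pmulr_rge0// subr_ge0 => h.
have : G / (Q + G + 1) * Q <= G.
  rewrite mulrAC ler_pdivrMr; last lra.
  by rewrite ler_pM2l//; lra.
by move=> h'; exfalso; lra.
Qed.

Lemma convex_setP (M : lmodType R) (C : set M) : convex_set C <->
  forall a b u v, 0 <= a -> 0 <= b -> a + b = 1 -> C u -> C v ->
    C (a *: u + b *: v).
Proof.
split=> [cC a b u v a0 b0 ab Cu Cv|cC u v l].
  have a1 : a <= 1 by lra.
  have := cC u v (Itv01 a0 a1); rewrite !inE => /(_ Cu Cv).
  by rewrite /conv/= /unstable.onem (_ : 1 - a = b); last lra.
rewrite !inE => Cu Cv; apply: cC => //; last by rewrite unstable.add_onemK.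
by rewrite unstable.onem_ge0.
Qed.

(** Dividing by the total weight makes the induction on s go through. *)
Lemma convex_sum (M : lmodType R) (C : set M) (I : eqType) (s : seq I)
    (l : I -> R) (c : I -> M) :
  convex_set C -> (forall i, 0 <= l i) -> (forall i, C (c i)) ->
  0 < \sum_(i <- s) l i -> C ((\sum_(i <- s) l i)^-1 *: \sum_(i <- s) l i *: c i).
Proof.
move=> /convex_setP cC l0 Cc; elim: s => [|i s IH]; first by rewrite big_nil ltxx.
rewrite !big_cons; have S0 : 0 <= \sum_(j <- s) l j by apply: sumr_ge0.
move=> L0; have [S1|S1] := eqVneq (\sum_(j <- s) l j) 0.
  rewrite S1 addr0 big1_seq ?addr0 ?scalerA ?mulVf ?scale1r//.
    by move: L0; rewrite S1 addr0 => /lt0r_neq0.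
  move=> j /= js; move/eqP: S1; rewrite psumr_eq0// => /allP/(_ _ js)/eqP ->.
  by rewrite scale0r.
set S := \sum_(j <- s) l j in S0 S1 L0 *; set L := l i + S in L0 *.
have Sgt0 : 0 < S by rewrite lt0r S1.
have -> : L^-1 *: (l i *: c i + \sum_(j <- s) l j *: c j) =
    (l i / L) *: c i + (S / L) *: (S^-1 *: \sum_(j <- s) l j *: c j).
  rewrite scalerDr !scalerA; congr (_ *: _ + _ *: _); first by rewrite mulrC.
  by rewrite mulrAC divff// mul1r.
apply: cC => //; try by rewrite divr_ge0// ltW.
  by rewrite -mulrDl divff// gt_eqF.
exact: IH.
Qed.

End Minimax.

(** * The duality between V and its Koethe dual *)

Section Duality.
Variables (R : realType) (T : choiceType) (V : set (vfun R T)).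
Hypothesis linV : linear_subspace V.
Implicit Types (u v w : vfun R T) (Omega : set (vfun R T)).

Lemma subspace_lin (a b : R) u v : V u -> V v -> V (a *: u + b *: v).
Proof.
move=> Vu Vv; have [V0 VD] := linV; apply: (VD) => //.
by rewrite -[b *: v]addr0; exact: VD.
Qed.

Lemma subspaceB u v : V u -> V v -> V (u - v).
Proof.
by move=> Vu Vv; have := subspace_lin 1 (-1) Vu Vv; rewrite scale1r scaleN1r.
Qed.

Lemma subspace_sum (I : Type) (s : seq I) (l : I -> R) (c : I -> vfun R T) :
  (forall i, V (c i)) -> V (\sum_(i <- s) l i *: c i).
Proof.
move=> Vc; elim: s => [|i s IH]; first by rewrite big_nil; case: linV.
by rewrite big_cons -[\sum_(_ <- s) _]scale1r; exact: subspace_lin.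
Qed.

Lemma pairing_linl (a b : R) u v w : V u -> V v -> dual_space V w ->
  pairing (a *: u + b *: v) w = a * pairing u w + b * pairing v w.
Proof.
move=> Vu Vv dw; rewrite -[RHS](usum_lin _ _ (dw _ Vu) (dw _ Vv)).
rewrite -[LHS]/(usum _); congr usum; apply/funext => x.
rewrite -[(_ + _) x]/(a * u x + b * v x).
by rewrite mulrDl !mulrA.
Qed.

Lemma pairing_suml (I : Type) (s : seq I) (l : I -> R) (c : I -> vfun R T) w :
  (forall i, V (c i)) -> dual_space V w ->
  pairing (\sum_(i <- s) l i *: c i) w = \sum_(i <- s) l i * pairing (c i) w.
Proof.
move=> Vc dw; elim: s => [|i s IH].
  have [V0 _] := linV; have := pairing_linl 0 0 V0 V0 dw.
  by rewrite !big_nil !scale0r addr0 !mul0r addr0.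
rewrite !big_cons -IH -[X in _ + X]scale1r pairing_linl ?mul1r//.
exact: subspace_sum.
Qed.

Lemma pairingBl u v w : V u -> V v -> dual_space V w ->
  pairing (u - v) w = pairing u w - pairing v w.
Proof.
move=> Vu Vv dw; have := pairing_linl 1 (-1) Vu Vv dw.
by rewrite scale1r scaleN1r mul1r mulN1r.
Qed.

Lemma pairing_linr (a b : R) u v w : V w -> dual_space V u -> dual_space V v ->
  pairing w (a *: u + b *: v) = a * pairing w u + b * pairing w v.
Proof.
move=> Vw du dv; rewrite -[RHS](usum_lin _ _ (du _ Vw) (dv _ Vw)).
rewrite -[LHS]/(usum _); congr usum; apply/funext => x.
rewrite -[(_ + _) x]/(a * u x + b * v x).
by rewrite mulrDr !mulrA ![w x * _]mulrC.
Qed.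

Lemma dual_lin (a b : R) u v : dual_space V u -> dual_space V v ->
  dual_space V (a *: u + b *: v).
Proof.
move=> du dv w Vw; have := abs_summable_lin a b (du _ Vw) (dv _ Vw).
rewrite (_ : (fun x => _) = (fun x => w x * (a *: u + b *: v) x))//.
apply/funext => x; rewrite -[(_ + _) x]/(a * u x + b * v x).
by rewrite mulrDr !mulrA ![w x * _]mulrC.
Qed.

Definition in_weak_dual w' (d : dual_space V w') : weak_dual V :=
  exist (fun x => x \in dual_space V) w' (mem_set d).

Lemma in_weak_dualE w' (d : dual_space V w') : set_val (in_weak_dual d) = w'.
Proof. by rewrite set_valE. Qed.

Lemma weak_dualP (x : weak_dual V) : dual_space V (set_val x).
Proof. by rewrite set_valE; exact: set_valP. Qed.

Lemma continuous_to_weak_dual (X : topologicalType) (f : X -> weak_dual V) :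
  (forall w, V w -> continuous (fun x => pairing w (set_val (f x)))) ->
  continuous f.
Proof.
move=> cf x A; rewrite (@nbhsE (weak_dual V)) => -[B [oB Bx] BA].
case: oB Bx BA => D sD <- [C DC Cx] sCA.
apply: (@filterS _ _ _ (f @^-1` C)).
  by move=> y Cy; apply: sCA; exists C.
have [E sE EC] := sD _ DC; rewrite -EC preimage_bigcap.
apply: filter_bigI => U UE; have := sE _ UE; rewrite inE => -[w [Vw [W oW UO]]].
have Ux : U (f x) by move: Cx; rewrite -EC => /(_ U UE).
rewrite UO /=; apply: (cf w Vw x W); apply: open_nbhs_nbhs; split => //.
by move: Ux; rewrite UO.
Qed.

Lemma weak_continuous w : V w ->
  continuous (fun x : weak_dual V => pairing w (set_val x)).
Proof.
move=> Vw; apply/continuousP => W oW.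
exists [set [set x : weak_dual V | W (pairing w (set_val x))]]; last first.
  by rewrite bigcup_set1.
move=> _ ->; exists [fset [set x : weak_dual V | W (pairing w (set_val x))]]%fset.
  move=> U /fset1P ->; rewrite inE; exists w; split => //.
  by exists W.
by rewrite set_fset1 bigcap_set1.
Qed.

(** Continuous images of compact sets supply the compact sets of V' that are
used below: segments and sums. *)
Lemma mackey_index_image (X : topologicalType) (K : set X) (f : X -> vfun R T) :
  compact K -> (forall x, dual_space V (f x)) ->
  (forall w, V w -> continuous (fun x => pairing w (f x))) ->
  absolutely_convex (f @` K) -> mackey_index V (f @` K).
Proof.
move=> cK df cf acK; split => //; first by move=> _ [x _ <-].
pose F x := in_weak_dual (df x).
have cF : continuous F.
  apply: continuous_to_weak_dual => w Vw.
  by rewrite (_ : (fun x => _) = (fun x => pairing w (f x)));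
    [exact: cf|apply/funext => x; rewrite in_weak_dualE].
have -> : set_val @^-1` (f @` K) = F @` K.
  apply/seteqP; split => [y [x Kx fx]|_ [x Kx <-]]; last first.
    by exists x => //; rewrite in_weak_dualE.
  by exists x => //; apply: val_inj; rewrite -[LHS]/(f x) fx set_valE.
apply: continuous_compact => //; exact: continuous_subspaceT.
Qed.

Lemma mackey_index_bounded Omega w : mackey_index V Omega -> V w ->
  exists M, forall w', Omega w' -> `|pairing w w'| <= M.
Proof.
move=> [dO _ cO] Vw.
have [[w0 Ow0]|no] := pselect (Omega !=set0); last first.
  by exists 0 => w' Ow'; case: no; exists w'.
have cf : {within (set_val @^-1` Omega : set (weak_dual V)),
    continuous (fun x : weak_dual V => `|pairing w (set_val x)|)}.
  apply: continuous_subspaceT => x.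
  exact: (cvg_norm (@weak_continuous w Vw x)).
have [|x _ xmax] := compact_EVT_max _ cO cf.
  by exists (in_weak_dual (dO _ Ow0)); rewrite /= in_weak_dualE.
exists `|pairing w (set_val x)| => w' Ow'.
by have := xmax (in_weak_dual (dO _ Ow')); rewrite inE /= in_weak_dualE; exact.
Qed.

Lemma ler_sup_seminorm Omega w w' : mackey_index V Omega -> V w -> Omega w' ->
  `|pairing w w'| <= sup_seminorm Omega w.
Proof.
move=> iO Vw Ow'; apply: ub_le_sup; last by exists w'.
by have [M MP] := mackey_index_bounded iO Vw; exists M => _ [v Ov <-]; exact: MP.
Qed.

Lemma sup_seminorm_le Omega w (c : R) : Omega !=set0 ->
  (forall w', Omega w' -> `|pairing w w'| <= c) -> sup_seminorm Omega w <= c.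
Proof.
move=> [w0 Ow0] Oc; apply: ge_sup; first by exists `|pairing w w0|, w0.
by move=> _ [v Ov <-]; exact: Oc.
Qed.

Lemma absolutely_convex0 Omega : absolutely_convex Omega -> Omega !=set0 ->
  Omega 0.
Proof.
move=> ac [w Ow]; have := ac 0 0 w w Ow Ow.
by rewrite !scale0r addr0 normr0 addr0; apply.
Qed.

Lemma mackey_index_line w' : dual_space V w' ->
  mackey_index V [set t *: w' | t in `[-1, 1] : set R].
Proof.
move=> dw'; have line t : dual_space V (t *: w').
  by have := dual_lin t 0 dw' dw'; rewrite scale0r addr0.
have pl w t : V w -> pairing w (t *: w') = t * pairing w w'.
  move=> Vw; have := pairing_linr t 0 Vw dw' dw'.
  by rewrite scale0r addr0 mul0r addr0.
apply: mackey_index_image => //; first exact: segment_compact.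
  move=> w Vw; rewrite (_ : (fun x => _) = (fun t => t * pairing w w')).
    by move=> t; apply: cvgM; [exact: cvg_id|exact: cvg_cst].
  by apply/funext => t; rewrite pl.
move=> a b _ _ [s s1 <-] [t t1 <-] ab; exists (a * s + b * t).
  move: s1 t1; rewrite /= !in_itv/= -!ler_norml => s1 t1.
  apply: le_trans ab; apply: le_trans (ler_normD _ _) _; rewrite !normrM.
  by apply: lerD; rewrite ler_piMr.
by rewrite scalerDl !scalerA.
Qed.

(** Sums make the family of seminorms directed: since 0 belongs to a nonempty
absolutely convex set, the sum contains both summands. *)
Lemma mackey_indexD Omega1 Omega2 :
  mackey_index V Omega1 -> mackey_index V Omega2 ->
  mackey_index V [set u + v | u in Omega1 & v in Omega2].
Proof.
move=> [d1 a1 c1] [d2 a2 c2].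
pose f (z : weak_dual V * weak_dual V) := set_val z.1 + set_val z.2.
pose K := (set_val @^-1` Omega1 : set (weak_dual V)) `*`
  (set_val @^-1` Omega2 : set (weak_dual V)).
have -> : [set u + v | u in Omega1 & v in Omega2] = f @` K.
  apply/seteqP; split => [_ [u Ou [v Ov <-]]|_ [[x y] [/= Ox Oy] <-]]; last first.
    by exists (set_val x) => //; exists (set_val y).
  exists (in_weak_dual (d1 _ Ou), in_weak_dual (d2 _ Ov));
    by rewrite /f /K /= !in_weak_dualE.
have pf w z : V w ->
    pairing w (f z) = pairing w (set_val z.1) + pairing w (set_val z.2).
  move=> Vw; have := pairing_linr 1 1 Vw (weak_dualP z.1) (weak_dualP z.2).
  by rewrite !scale1r !mul1r.
apply: mackey_index_image; first exact: compact_setX.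
- move=> z; have := dual_lin 1 1 (weak_dualP z.1) (weak_dualP z.2).
  by rewrite !scale1r.
- move=> w Vw.
  rewrite (_ : (fun x => _) = (fun z : weak_dual V * weak_dual V =>
      pairing w (set_val z.1) + pairing w (set_val z.2))); last first.
    by apply/funext => z; rewrite pf.
  move=> z; apply: cvgD.
    apply: (@continuous_comp _ _ _ fst
        (fun x : weak_dual V => pairing w (set_val x))).
      exact: cvg_fst.
    exact: weak_continuous.
  apply: (@continuous_comp _ _ _ snd
        (fun x : weak_dual V => pairing w (set_val x))).
      exact: cvg_snd.
    exact: weak_continuous.
move=> a b _ _ [[x y] [/= Ox Oy] <-] [[x' y'] [/= Ox' Oy'] <-] ab.
have O1 := a1 a b _ _ Ox Ox' ab; have O2 := a2 a b _ _ Oy Oy' ab.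
exists (in_weak_dual (d1 _ O1), in_weak_dual (d2 _ O2)).
  by rewrite /K /= !in_weak_dualE.
rewrite /f /= !in_weak_dualE.
by rewrite !scalerDr addrACA.
Qed.

End Duality.

(** * Mackey neighbourhoods and closures *)

Section Mackey.
Variables (R : realType) (T : choiceType) (V : set (vfun R T)).
Hypothesis linV : linear_subspace V.
Implicit Types (u v w : vfun R T) (Omega C : set (vfun R T)).

Lemma mackeyP (x : mackey_space V) : V (set_val x).
Proof. by rewrite set_valE; exact: set_valP. Qed.

Definition in_mackey w (Vw : V w) : mackey_space V :=
  exist (fun x => x \in V) w (mem_set Vw).

Lemma in_mackeyE w (Vw : V w) : set_val (in_mackey Vw) = w.
Proof. by rewrite set_valE. Qed.

Lemma dual0 : dual_space V 0.
Proof.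
move=> w Vw; apply/abs_summableP; exists 0 => s us.
by rewrite big1// => x _; rewrite mulr0 normr0.
Qed.

(** The seminorms are directed, so that a neighbourhood contains a ball of a
single one of them. *)
Lemma mackey_nbhs (w : mackey_space V) (B : set (mackey_space V)) :
  nbhs w B -> exists Omega (eps : R),
    [/\ mackey_index V Omega, Omega !=set0, 0 < eps &
    forall u : mackey_space V, sup_seminorm Omega (set_val u - set_val w) < eps -> B u].
Proof.
rewrite (@nbhsE (mackey_space V)) => -[_ [[D sD <-] [C DC Cw]] CB].
have [E sE EC] := sD _ DC.
suff ball : exists Omega (eps : R),
    [/\ mackey_index V Omega, Omega !=set0, 0 < eps &
    forall u : mackey_space V, sup_seminorm Omega (set_val u - set_val w) < eps ->
      forall U, U \in (E : seq _) -> U u].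
  have [ Omega [eps [iO O0 e0 OE]]] := ball.
  exists Omega, eps; split => // u /OE uE; apply: CB.
  have Cu : C u by rewrite -EC => U; exact: uE.
  by exists C.
have : forall U, U \in (E : seq _) -> mackey_subbase U /\ U w.
  move=> U UE; split; first by have := sE _ UE; rewrite inE.
  have Cw' : C w by [].
  by move: Cw'; rewrite -EC => /(_ U UE).
elim: (E : seq _) => [_|U s IH sUw].
  exists [set t *: 0 | t in `[-1, 1] : set R], 1; split => //.
    exact: mackey_index_line dual0.
  by exists 0, 0; rewrite ?scale0r//= in_itv/= lerN10 ler01.
have [|Om2 [e2 [i2 n2 e20 O2]]] := IH.
  by move=> U' sU'; apply: sUw; rewrite inE sU' orbT.
have [|[ Om1 [i1 [v [r [r0 UE]]]]] Uw] := sUw U; first by rewrite inE eqxx.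
have [n1|n1] := pselect (Om1 !=set0); last first.
  (* the seminorm of the empty set is 0, so U is the whole space *)
  exists Om2, e2; split => // u /O2 us U'; rewrite inE => /orP[/eqP ->|/us//].
  rewrite UE /= /sup_seminorm (_ : [set _ | _ in _] = set0) ?sup0//.
  by apply/seteqP; split => [y [w' Ow' _]|//]; case: n1; exists w'.
have [_ a1 _] := i1; have [_ a2 _] := i2.
have z1 := absolutely_convex0 a1 n1; have z2 := absolutely_convex0 a2 n2.
have iO := mackey_indexD i1 i2; set Om := (X in mackey_index V X) in iO.
have s1 : Om1 `<=` Om by move=> x Ox; exists x => //; exists 0; rewrite ?addr0.
have s2 : Om2 `<=` Om by move=> x Ox; exists 0 => //; exists x; rewrite ?add0r.
move: Uw; rewrite UE /= => Uw.
have mono Omi u : Omi !=set0 -> Omi `<=` Om -> V u ->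
    sup_seminorm Omi u <= sup_seminorm Om u.
  move=> ni si Vu; apply: sup_seminorm_le => // w' /si.
  exact: (ler_sup_seminorm iO Vu).
exists Om, (Num.min e2 (r - sup_seminorm Om1 (set_val w - set_val v))).
split => //.
- by exists 0; exact: s1.
- by rewrite lt_min e20 subr_gt0.
move=> u; rewrite lt_min => /andP[h2 h1] U'; rewrite inE => /orP[/eqP ->|].
  rewrite ?UE /=.
  have Vuw : V (set_val u - set_val w) by apply: subspaceB => //; exact: mackeyP.
  have Vwv : V (set_val w - set_val v) by apply: subspaceB => //; exact: mackeyP.
  apply: (@le_lt_trans _ _ (sup_seminorm Om1 (set_val u - set_val w) +
      sup_seminorm Om1 (set_val w - set_val v))); last first.
    by have := mono _ _ n1 s1 Vuw; lra.
  apply: sup_seminorm_le => // w' Ow'.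
  have dw' : dual_space V w' by case: i1 => d1 _ _; exact: d1.
  have -> : pairing (set_val u - set_val v) w' =
     pairing (set_val u - set_val w) w' + pairing (set_val w - set_val v) w'.
    by rewrite !(@pairingBl _ _ V) ?subrKA//; exact: mackeyP.
  apply: le_trans (ler_normD _ _) _.
  by apply: lerD; apply: (ler_sup_seminorm i1).
apply: O2; apply: le_lt_trans h2; apply: mono => //.
by apply: subspaceB => //; exact: mackeyP.
Qed.

Lemma nbhs_mackey_ball Omega (w : mackey_space V) (eps : R) :
  mackey_index V Omega -> 0 < eps ->
  nbhs w [set u : mackey_space V | sup_seminorm Omega (set_val u - set_val w) < eps].
Proof.
move=> iO e0; set U := [set u : mackey_space V | _].
have bU : mackey_subbase U by exists Omega; split => //; exists w, eps.
have Uw : U w.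
  rewrite /U /= subrr; have [n0|n0] := pselect (Omega !=set0); last first.
    rewrite /sup_seminorm (_ : [set _ | _ in _] = set0) ?sup0//.
    by apply/seteqP; split => [y [w' Ow' _]|//]; case: n0; exists w'.
  apply: le_lt_trans e0; apply: sup_seminorm_le => // w' Ow'.
  have dw' : dual_space V w' by case: iO => d _ _; exact: d.
  have := pairingBl (mackeyP w) (mackeyP w) dw'.
  by rewrite !subrr => ->; rewrite normr0.
rewrite (@nbhsE (mackey_space V)); exists U => //; split => //.
exists [set U]; last by rewrite bigcup_set1.
move=> _ ->; exists [fset U]%fset; last by rewrite set_fset1 bigcap_set1.
by move=> U' /fset1P ->; rewrite inE.
Qed.

(** Each w' in V' defines a Mackey continuous functional, since the segment
from - w' to w' is an absolutely convex compact set. *)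
Lemma mackey_closure_weak C w : mackey_closure V C w -> V w /\
  forall w' eps, dual_space V w' -> 0 < eps ->
    exists c, [/\ C c, V c & `|pairing c w' - pairing w w'| < eps].
Proof.
move=> [x clx <-]; split; first exact: mackeyP.
move=> w' eps dw' e0; have iO := mackey_index_line dw'.
have [c [Cc cb]] := clx _ (nbhs_mackey_ball x iO e0).
exists (set_val c); split => //; first exact: mackeyP.
rewrite -(@pairingBl _ _ V) //; [|exact: mackeyP|exact: mackeyP].
apply: le_lt_trans cb; apply: (ler_sup_seminorm iO).
  by apply: subspaceB => //; exact: mackeyP.
exists 1; last exact: scale1r.
by rewrite /= in_itv/= lexx andbT; lra.
Qed.

(** A convex set has the same weak and Mackey closures.  Instead of
separating w from C by a functional, one uses the compactness of Omega and the
minimax principle to find a single w' in Omega on which all c in C are far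
below w. *)
Lemma weak_mackey_closure C w : convex_set C -> C `<=` V -> V w ->
  (forall w' eps, dual_space V w' -> 0 < eps ->
     exists2 c, C c & pairing w w' - eps <= pairing c w') ->
  mackey_closure V C w.
Proof.
move=> cC CV Vw hw; exists (in_mackey Vw); last by rewrite in_mackeyE.
move=> B /mackey_nbhs[ Omega [eps [iO n0 e0 OB]]].
suff close : exists2 c, C c & sup_seminorm Omega (c - w) < eps.
  have [c Cc hc] := close.
  exists (in_mackey (CV _ Cc)); split; first by rewrite /= in_mackeyE.
  by apply: OB; rewrite !in_mackeyE.
apply: contrapT => no; have [dO aO cO] := iO.
pose W : set (weak_dual V) := set_val @^-1` Omega.
pose h := eps / 2.
have h0 : 0 < h by rewrite divr_gt0.
have far c : C c -> exists2 w', Omega w' & h <= pairing (w - c) w'.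
  move=> Cc; apply: contrapT => nof; apply: no; exists c => //.
  apply: (@le_lt_trans _ _ h); last by rewrite /h; lra.
  apply: sup_seminorm_le => // w' Ow'.
  have Vc := CV _ Cc; have dw' := dO _ Ow'.
  have lt1 v' : Omega v' -> pairing (w - c) v' < h.
    by move=> Ov'; rewrite ltNge; apply/negP => le; apply: nof; exists v'.
  (* Omega is symmetric, so one-sided bounds suffice *)
  have ONw' : Omega (- w').
    have := aO (-1) 0 w' w' Ow' Ow'.
    rewrite scaleN1r scale0r addr0 normrN1 normr0 addr0.
    exact.
  have := lt1 _ Ow'; have := lt1 _ ONw'.
  have -> : pairing (w - c) (- w') = - pairing (w - c) w'.
    have := pairing_linr (-1) 0 (subspaceB linV Vw Vc) dw' dw'.
    by rewrite scaleN1r scale0r addr0 mulN1r mul0r addr0.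
  rewrite !(@pairingBl _ _ V)// ler_norml; lra.
pose K c := [set x : weak_dual V | W x /\ h <= pairing (w - c) (set_val x)].
have clK c : C c -> closed [set x : weak_dual V | h <= pairing (w - c) (set_val x)].
  move=> Cc; apply: (@closed_comp _ _
    (fun x : weak_dual V => pairing (w - c) (set_val x)) [set y | h <= y]);
    last exact: closed_ge.
  move=> x _; apply: weak_continuous.
  by apply: subspaceB => //; exact: CV.
have finK : finI C K.
  move=> D DC.
  have Ci (i : D) : C (val i) by have := DC _ (valP i); rewrite inE.
  pose f (i : D) (x : weak_dual V) := pairing (w - val i) (set_val x).
  have Vwi (i : D) : V (w - val i) by apply: subspaceB => //; exact/CV/Ci.
  have [|||||x Wx hx] := @finite_minimax R (weak_dual V) W D f h.
  - have [w0 Ow0] := n0; exists (in_weak_dual (dO _ Ow0)).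
    by rewrite /W /= in_weak_dualE.
  - exact: cO.
  - by move=> i; exact: weak_continuous.
  - move=> x y t Wx Wy /andP[t0 t1].
    have Oz : Omega ((1 - t) *: set_val x + t *: set_val y).
      apply: aO => //; rewrite !ger0_norm; lra.
    exists (in_weak_dual (dO _ Oz)); first by rewrite /W /= in_weak_dualE.
    move=> i; rewrite /f in_weak_dualE (pairing_linr _ _ (Vwi i)).
    + by ring.
    + exact: weak_dualP.
    + exact: weak_dualP.
  - move=> l l0 l1; pose c := \sum_i l i *: val (i : D).
    have Cc : C c.
      have := @convex_sum R _ C _ (index_enum D) l (fun i => val i) cC l0 Ci.
      by rewrite l1 invr1 scale1r; apply.
    have [w' Ow' hw'] := far c Cc.
    exists (in_weak_dual (dO _ Ow')); first by rewrite /W /= in_weak_dualE.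
    apply: le_trans hw' _; rewrite /f in_weak_dualE.
    have dw' := dO _ Ow'.
    rewrite (@pairingBl _ _ V)//; last exact: CV.
    rewrite [leRHS](_ : _ =
      \sum_i l i * (pairing w w' - pairing (val (i : D)) w')); last first.
      by apply: eq_bigr => i _; rewrite (@pairingBl _ _ V)//; exact/CV/Ci.
    under [leRHS]eq_bigr do rewrite mulrBr.
    rewrite sumrB -mulr_suml l1 mul1r lerD2l lerN2 /c.
    by rewrite (pairing_suml linV)// => i; exact/CV/Ci.
  exists x => i iD; split => //.
  exact: (hx [` iD]%fset).
have FF := finI_filter finK.
have [c0 Cc0] : C !=set0.
  by have [c Cc _] := hw 0 1 dual0 ltr01; exists c.
have [|x [Wx clx]] := cO _ FF.
  by exists (K c0); [exact: finI_from1|move=> y []].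
have dx := weak_dualP x.
have [|c Cc hc] := hw (set_val x) (h / 2) dx; first by rewrite divr_gt0.
have : h <= pairing (w - c) (set_val x).
  apply: (clK c Cc) => B' nB'.
  have [|y [[_ hy] By]] := clx (K c) B' _ nB'.
    by exists (K c) => //; exact: finI_from1.
  by exists y.
by rewrite (@pairingBl _ _ V)//; [lra|exact: CV].
Qed.

End Mackey.

(** * The set S in terms of the pairing, and the theorem *)

Section SetSums.
Variables (R : realType) (T : choiceType).
Implicit Types (A : set T) (u v w : vfun R T) (GG : set (set T)).

Local Notation ind A := (\1_A : T -> R).

Lemma esum_pairing A u : (forall x, 0 <= u x) ->
  abs_summable (fun x => u x * ind A x) ->
  (\esum_(x in A) (u x)%:E = (pairing u (ind A))%:E)%E.
Proof.
move=> u0 /abs_summableP[M hM].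
have E : (\esum_(x in A) (u x)%:E =
    \esum_(x in [set: T]) (Num.max (u x * ind A x) 0)%:E)%E.
  rewrite esum_mkcond; apply: eq_esum => x _; rewrite indicE.
  by case: ifP => _; rewrite ?mulr1 ?mulr0 ?maxxx// max_l.
have p0 x : 0 <= u x * ind A x by rewrite mulr_ge0// indicE.
rewrite /pairing [X in _ - fine X]esum1 ?subr0; last first.
  by move=> x _; rewrite max_r// oppr_le0.
rewrite -E fineK// E ge0_fin_numE; last first.
  by apply: esum_ge0 => x _; rewrite lee_fin le_max lexx orbT.
apply: (@le_lt_trans _ _ M%:E); last exact: ltry.
apply/ge_esum_seqP => s us; rewrite lee_fin; apply: le_trans (hM s us).
by apply: ler_sum => x _; rewrite max_l// ger0_norm.
Qed.

Lemma S_set_summable GG GG1 A w : S_set GG GG1 w -> GG A ->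
  abs_summable (fun x => w x * ind A x).
Proof.
move=> Sw GA; apply/abs_summableP; exists 1 => s us.
have [w0 _ _] := Sw.
have <- : \sum_(x <- s | x \in A) w x = \sum_(x <- s) `|w x * ind A x|.
  rewrite big_mkcond; apply: eq_bigr => x _; rewrite indicE.
  by case: ifP; rewrite ?mulr1 ?mulr0 ?normr0// ger0_norm.
rewrite -big_filter; apply: (S_set_sum_le1 Sw GA); first exact: filter_uniq.
by move=> x; rewrite mem_filter => /andP[]; rewrite inE.
Qed.

(** This trades the extended sums in the definition of S for the functionals
<w, 1_A>, which are linear and, on V, Mackey continuous. *)
Lemma S_set_pairingP GG GG1 w : GG1 `<=` GG -> S_set GG GG1 w <->
  [/\ forall x, 0 <= w x,
      forall A, GG A -> abs_summable (fun x => w x * ind A x),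
      forall A, GG A -> pairing w (ind A) <= 1 &
      forall A, GG1 A -> pairing w (ind A) = 1].
Proof.
move=> GG1G; split=> [Sw|[w0 sw wle weq]].
  have [w0 wle weq] := Sw; have sw A := S_set_summable (A := A) Sw.
  split=> // A GA; [have := wle _ GA|have := weq _ GA]; rewrite esum_pairing//.
  - exact: sw.
  - by move=> [].
  - exact/sw/GG1G.
have E A : GG A -> (\esum_(x in A) (w x)%:E = (pairing w (ind A))%:E)%E.
  by move=> GA; apply: esum_pairing => //; exact: sw.
split=> // A GA; first by rewrite E// lee_fin wle.
by rewrite E ?weq//; exact: GG1G.
Qed.

Lemma S_set_convex GG GG1 : GG1 `<=` GG ->
  convex_set (S_set GG GG1 : set (vfun R T)).
Proof.
move=> GG1G; apply/convex_setP => a b u v a0 b0 ab.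
move=> /(S_set_pairingP _ GG1G)[u0 su ule ueq].
move=> /(S_set_pairingP _ GG1G)[v0 sv vle veq]; apply/(S_set_pairingP _ GG1G).
have E A : (fun x => (a *: u + b *: v) x * ind A x) =
    (fun x => a * (u x * ind A x) + b * (v x * ind A x)).
  by apply/funext => x; rewrite -[(_ + _) x]/(a * u x + b * v x); ring.
have pE A : GG A -> pairing (a *: u + b *: v) (ind A) =
    a * pairing u (ind A) + b * pairing v (ind A).
  move=> GA; rewrite -[RHS](usum_lin _ _ (su _ GA) (sv _ GA)).
  by rewrite -[LHS]/(usum _) E.
split=> [x|A GA|A GA|A GA].
- by rewrite -[(_ + _) x]/(a * u x + b * v x) addr_ge0// mulr_ge0.
- by rewrite E; apply: abs_summable_lin; [exact: su|exact: sv].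
- rewrite pE// -ab; apply: lerD; rewrite -[leRHS]mulr1 ler_wpM2l//.
    exact: ule.
  exact: vle.
- by rewrite pE ?ueq ?veq ?mulr1//; exact: GG1G.
Qed.

Lemma S_setS GG GG1 : S_set GG GG1 `<=` (S_set GG set0 : set (vfun R T)).
Proof. by move=> w [w0 wle _]; split. Qed.

(** The sums over A of the members of S are at most 1, and finiteness of the
sum over A passes to linear combinations and to dominated functions. *)
Lemma indicator_dual GG A : GG A -> dual_space (V_S GG) (ind A).
Proof.
move=> GA w [v Sv wv]; apply/abs_summableP.
suff /abs_summableP[M hM] : abs_summable (fun x => v x * ind A x).
  exists M => s us; apply: le_trans (hM s us).
  by apply: ler_sum => x _; rewrite !normrM ler_wpM2r.
move: v Sv {wv}; apply: smallest_sub.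
  split.
    apply/abs_summableP; exists 0 => s us.
    by rewrite big1// => x _; rewrite mul0r normr0.
  move=> a u v su sv; have := abs_summable_lin a 1 su sv.
  rewrite (_ : (fun x => _ + _) = (fun x => (a *: u + v) x * ind A x))//.
  by apply/funext => x; rewrite -[(_ + _) x]/(a * u x + v x); ring.
by move=> v Sv; exact: S_set_summable Sv GA.
Qed.

Lemma dual_subset (V W : set (vfun R T)) : V `<=` W ->
  dual_space W `<=` dual_space V.
Proof. by move=> VW w dw v /VW; exact: dw. Qed.

(** The values at the vertices are given by functionals of every dual space. *)
Lemma pairing_delta (x : T) w :
  abs_summable (fun y => w y * ind [set x] y) /\ pairing w (ind [set x]) = w x.
Proof.
have delta s : uniq s -> \sum_(y <- s) w y * ind [set x] y = if x \in s then w x else 0.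
  move=> us; case: ifP => xs.
    rewrite (bigD1_seq x)//= indicE mem_set// mulr1 big1 ?addr0// => y yx.
    by rewrite indicE memNset ?mulr0// => /eqP; rewrite (negbTE yx).
  rewrite big1_seq// => y /= ys; rewrite indicE memNset ?mulr0//= => yx.
  by rewrite yx xs in ys.
have sm : abs_summable (fun y => w y * ind [set x] y).
  apply/abs_summableP; exists `|w x| => s us.
  have [xs|xs] := boolP (x \in s).
    rewrite (bigD1_seq x)//= indicE mem_set// mulr1 big1 ?addr0// => y yx.
    by rewrite indicE memNset ?mulr0 ?normr0// => /eqP; rewrite (negbTE yx).
  rewrite big1_seq// => y /= ys; rewrite indicE memNset ?mulr0 ?normr0//= => yx.
  by move: xs; rewrite -yx ys.
split => //; apply: usum_unique => // eps e0; exists [:: x] => // s us xs.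
rewrite delta// xs ?inE// subrr normr0; exact: ltW.
Qed.

End SetSums.

Theorem theorem2p15 (R : realType) (T : choiceType) (GG : set (set T))
    (V : set (vfun R T)) :
  countable_family GG ->
  cond_g1 GG -> cond_g2 GG -> cond_g3 GG ->
  linear_subspace V -> normal_set V ->
  V_P GG `<=` V -> V `<=` V_S GG ->
  forall GG1 : set (set T), GG1 `<=` GG ->
    S_set GG GG1 `&` V = mackey_closure V (conv_hull (P_set GG GG1)).
Proof.
move=> cG g1 g2 _ linV _ VPV VVS GG1 GG1G.
pose C := conv_hull (P_set GG GG1) : set (vfun R T).
have PV : P_set GG GG1 `<=` V.
  move=> p [Sp p01]; apply: VPV; exists p => //; apply: sub_gen_smallest.
  by split => //; exact: S_setS Sp.
have PC : P_set GG GG1 `<=` C by exact: sub_gen_smallest.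
have cC : convex_set C.
  apply/convex_setP => a b u v a0 b0 ab Cu Cv D [cD PD].
  by move/convex_setP : (cD); apply => //; [exact: Cu|exact: Cv].
have CV : C `<=` V.
  apply: smallest_sub => //; apply/convex_setP => a b u v _ _ _ Vu Vv.
  exact: subspace_lin.
have CS : C `<=` S_set GG GG1.
  by apply: smallest_sub; [exact: S_set_convex|move=> p []].
apply/seteqP; split => [w [Sw Vw]|w /(mackey_closure_weak linV)[Vw cw]].
  apply: weak_mackey_closure => // w' eps dw' e0.
  have sP p : P_set GG GG1 p -> abs_summable (fun x => p x * w' x).
    by move=> /PV; exact: dw'.
  have [p Pp hp] := P_set_pairing_ge cG g1 g2 GG1G Sw (dw' _ Vw) sP e0.
  by exists p => //; exact: PC.
split => //.
have dA A : GG A -> dual_space V (\1_A : vfun R T).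
  by move=> GA; apply: dual_subset VVS _ (indicator_dual GA).
apply/(S_set_pairingP _ GG1G); split=> [x|A GA|A GA|A GA].
- have dx : dual_space V (\1_[set x] : vfun R T).
    by move=> u _; case: (pairing_delta x u).
  rewrite leNgt; apply/negP => wx.
  have [|c [Cc Vc]] := cw _ (- w x) dx; first by rewrite oppr_gt0.
  rewrite (pairing_delta x c).2 (pairing_delta x w).2 ltr_norml => /andP[_].
  by have [c0 _ _] := CS _ Cc; have := c0 x; lra.
- exact: dA.
- apply/ler_addgt0Pr => eps e0; have [c [Cc Vc]] := cw _ _ (dA _ GA) e0.
  have [_ _ /(_ _ GA) cle _] := (S_set_pairingP c GG1G).1 (CS _ Cc).
  by rewrite ltr_norml => /andP[? ?]; lra.
- apply/eqP; rewrite -subr_eq0 -normr_le0; apply/ler_addgt0Pr => eps e0.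
  have [c [Cc Vc]] := cw _ _ (dA _ (GG1G _ GA)) e0.
  have [_ _ _ /(_ _ GA) ->] := (S_set_pairingP c GG1G).1 (CS _ Cc).
  by rewrite distrC add0r => /ltW.
Qed.
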